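(* Let $\sigma(x)$ be a smooth nowhere vanishing function on an open interval, let $C^{x}(x)$ be a smooth function there, and consider the equation $$\Delta F-C^{x}(x)F_{,x}-F_{,t}=0,\qquad \Delta F=\tfrac12\sigma^{2}F_{,xx}+\tfrac12\sigma\sigma_{,x}F_{,x},$$ for $F=F(t,x)$. Write $y(x)=\int\frac{dx}{\sigma(x)}$ for a fixed antiderivative, $K^{1}=\sigma(x)\partial_{x}$ and $H=\sigma(x)\,y(x)\,\partial_{x}$. Suppose that the Killing vector $K^{1}$ generates a Lie point symmetry of the equation, i.e. there is a not identically zero function $T(t)$ such that $T(t)K^{1}$ is a Lie point symmetry. Then there are constants $m,c$ such that $$C^{x}(x)=m\,\sigma(x)\,y(x)+c\,\sigma(x),$$ and the equation is maximally symmetric. Moreover, besides the autonomous symmetry $\partial_t$, the homogeneous symmetry $F\partial_F$ and the infinity symmetries $b(t,x)\partial_F$ (with $b$ a solution of the equation), the symmetry vectors are the following. (i) For $m\neq0$, $c=0$: $$Z^{1}=e^{mt}K^{1},\qquad Z^{2}=e^{-mt}\big(K^{1}+2m\,y\,F\partial_{F}\big),\qquad Z^{3}=e^{2mt}\big(\partial_{t}+mH\big),$$ $$Z^{4}=e^{-2mt}\big(\partial_{t}-mH-m(2m\,y^{2}-1)F\partial_{F}\big).$$ (ii) For $m\neq0$, $c\neq0$: $$Z^{1}=e^{mt}K^{1},\qquad Z^{2}=e^{-mt}\big(K^{1}+2(m\,y+c)F\partial_{F}\big),\qquad Z^{3}=e^{2mt}\big(\partial_{t}+mH+cK^{1}\big),$$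 $$Z^{4}=e^{-2mt}\big(\partial_{t}-mH-cK^{1}-(2m^{2}y^{2}+4mc\,y+2c^{2}-m)F\partial_{F}\big).$$ (iii) For $m=0$, $c\neq0$: $$Z^{1}=K^{1},\qquad Z^{2}=tK^{1}-(y-ct)F\partial_{F},\qquad Z^{3}=2t\partial_{t}+H+ct\,K^{1},$$ $$Z^{4}=t^{2}\partial_{t}+tH+\frac{t}{2c}K^{1}-\Big(\tfrac12 y^{2}+\tfrac{1}{2c}y-ct\,y+\tfrac{c^{2}}{2}t^{2}\Big)F\partial_{F}.$$
   Context: The operator $\Delta$ is the Laplace operator of the one-dimensional metric $\frac{2}{\sigma^{2}(x)}dx^{2}$, whose homothetic algebra is two-dimensional, spanned by the Killing vector $K^{1}$ and the proper homothetic vector $H$ (homothetic factor $1$). In the space-dependent one-factor model of commodities one has $C^{x}=-\big(\kappa(\mu-\lambda-x)-\tfrac12\sigma^{2}-\tfrac12\sigma\sigma_{,x}\big)$ with $\kappa,\mu,\lambda,\sigma$ functions of $x$, but the statement holds for arbitrary $C^x$. A Lie point symmetry of the equation is a vector field $X=\xi^{t}\partial_t+\xi^{x}\partial_x+\eta\,\partial_F$, with coefficients functions of $(t,x,F)$, whose second prolongation annihilates the equation on its solution set. Commas denote partial derivatives. ''Maximally symmetric'' means that the equation admits $5+1+\infty$ Lie point symmetries: the Lie point symmetry algebra is spanned by five symmetries (here $\partial_t,Z^1,\dots,Z^4$), the homogeneous symmetry $F\partial_F$, and the infinity symmetries $b(t,x)\partial_F$ with $b$ any solution of the equation; this is the same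 dimension as for the heat equation. *)

(* Defs.v *)
From Stdlib Require Import Reals.
From Coquelicot Require Import Coquelicot.
Set Implicit Arguments.
Unset Strict Implicit.
Unset Printing Implicit Defensive.
Open Scope R_scope.

Definition open_itv (a b : Rbar) (x : R) : Prop :=
  Rbar_lt a x /\ Rbar_lt x b.

Definition smooth_on (I : R -> Prop) (f : R -> R) : Prop :=
  forall (n : nat) (x : R), I x -> ex_derive_n f n x.

(* Functions of (t, x, F) on the domain R * I * R: [t] and [F] range over the
   whole line and only [x] is restricted, to the open set [I]. *)

Definition fun3 := R -> R -> R -> R.

Definition d1 (f : fun3) : fun3 := fun t x u => Derive (fun s => f s x u) t.
Definition d2 (f : fun3) : fun3 := fun t x u => Derive (fun s => f t s u) x.
Definition d3 (f : fun3) : fun3 := fun t x u => Derive (fun s => f t x s) u.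

Fixpoint Ck (I : R -> Prop) (n : nat) (f : fun3) : Prop :=
  (forall t x u, I x ->
     continuous (fun p : R * R * R => f (fst (fst p)) (snd (fst p)) (snd p))
                (t, x, u)) /\
  match n with
  | O => True
  | S k =>
      (forall t x u, I x ->
         ex_derive (fun s => f s x u) t /\
         ex_derive (fun s => f t s u) x /\
         ex_derive (fun s => f t x s) u) /\
      Ck I k (d1 f) /\ Ck I k (d2 f) /\ Ck I k (d3 f)
  end.

Definition smooth3 (I : R -> Prop) (f : fun3) : Prop :=
  forall n : nat, Ck I n f.

(* Coordinates (t, x, F, F_t, F_x, F_tt, F_tx, F_xx) of the second-order jet
   space; [u] stands for the dependent variable F. *)
Inductive coord := c_t | c_x | c_u | c_ut | c_ux | c_utt | c_utx | c_uxx.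

Definition jet := coord -> R.

Definition coord_eq_dec (c d : coord) : {c = d} + {c <> d}.
Proof. decide equality. Defined.

Definition upd (j : jet) (c : coord) (s : R) : jet :=
  fun d => if coord_eq_dec c d then s else j d.

Definition pd (c : coord) (G : jet -> R) (j : jet) : R :=
  Derive (fun s => G (upd j c s)) (j c).

(* Total derivatives. They are only applied to functions of the first-order jet
   (t, x, F, F_t, F_x), so no third-order coordinate is needed. *)
Definition Dt (G : jet -> R) (j : jet) : R :=
  pd c_t G j + j c_ut * pd c_u G j
  + j c_utt * pd c_ut G j + j c_utx * pd c_ux G j.
Definition Dx (G : jet -> R) (j : jet) : R :=
  pd c_x G j + j c_ux * pd c_u G j
  + j c_utx * pd c_ut G j + j c_uxx * pd c_ux G j.

Definition lift (f : fun3) (j : jet) : R := f (j c_t) (j c_x) (j c_u).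

(* xi_t d/dt + xi_x d/dx + eta d/dF *)
Record vfield := VField { xi_t : fun3; xi_x : fun3; eta : fun3 }.

Definition eta_t (X : vfield) (j : jet) : R :=
  Dt (lift (eta X)) j - j c_ut * Dt (lift (xi_t X)) j
                      - j c_ux * Dt (lift (xi_x X)) j.
Definition eta_x (X : vfield) (j : jet) : R :=
  Dx (lift (eta X)) j - j c_ut * Dx (lift (xi_t X)) j
                      - j c_ux * Dx (lift (xi_x X)) j.
Definition eta_tt (X : vfield) (j : jet) : R :=
  Dt (eta_t X) j - j c_utt * Dt (lift (xi_t X)) j - j c_utx * Dt (lift (xi_x X)) j.
Definition eta_tx (X : vfield) (j : jet) : R :=
  Dx (eta_t X) j - j c_utt * Dx (lift (xi_t X)) j - j c_utx * Dx (lift (xi_x X)) j.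
Definition eta_xx (X : vfield) (j : jet) : R :=
  Dx (eta_x X) j - j c_utx * Dx (lift (xi_t X)) j - j c_uxx * Dx (lift (xi_x X)) j.

Definition prolong2 (X : vfield) (E : jet -> R) (j : jet) : R :=
  lift (xi_t X) j * pd c_t E j + lift (xi_x X) j * pd c_x E j
  + lift (eta X) j * pd c_u E j
  + eta_t X j * pd c_ut E j + eta_x X j * pd c_ux E j
  + eta_tt X j * pd c_utt E j + eta_tx X j * pd c_utx E j
  + eta_xx X j * pd c_uxx E j.

(* The equation E = 0 is identified with the function E on the jet space. *)
Definition lie_symmetry (I : R -> Prop) (E : jet -> R) (X : vfield) : Prop :=
  smooth3 I (xi_t X) /\ smooth3 I (xi_x X) /\ smooth3 I (eta X) /\
  forall j : jet, I (j c_x) -> E j = 0 -> prolong2 X E j = 0.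

Definition jet_of (b : R -> R -> R) (t x : R) : jet := fun c =>
  match c with
  | c_t => t
  | c_x => x
  | c_u => b t x
  | c_ut => Derive (fun s => b s x) t
  | c_ux => Derive (fun z => b t z) x
  | c_utt => Derive (fun s => Derive (fun r => b r x) s) t
  | c_utx => Derive (fun z => Derive (fun s => b s z) t) x
  | c_uxx => Derive (fun z => Derive (fun w => b t w) z) x
  end.

Definition solution (I : R -> Prop) (E : jet -> R) (b : R -> R -> R) : Prop :=
  smooth3 I (fun t x _ => b t x) /\
  forall t x : R, I x -> E (jet_of b t x) = 0.

Definition laplace_jet (sigma : R -> R) (j : jet) : R :=
  / 2 * sigma (j c_x) ^ 2 * j c_uxx
  + / 2 * sigma (j c_x) * Derive sigma (j c_x) * j c_ux.

Definition equation (sigma Cx : R -> R) (j : jet) : R :=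
  laplace_jet sigma j - Cx (j c_x) * j c_ux - j c_ut.

Declare Scope vfield_scope.
Delimit Scope vfield_scope with VF.
Bind Scope vfield_scope with vfield.

Definition vadd (X Y : vfield) : vfield :=
  VField (fun t x u => xi_t X t x u + xi_t Y t x u)
         (fun t x u => xi_x X t x u + xi_x Y t x u)
         (fun t x u => eta X t x u + eta Y t x u).
Definition vmul (f : fun3) (X : vfield) : vfield :=
  VField (fun t x u => f t x u * xi_t X t x u)
         (fun t x u => f t x u * xi_x X t x u)
         (fun t x u => f t x u * eta X t x u).
Definition vscal (k : R) (X : vfield) : vfield := vmul (fun _ _ _ => k) X.

Notation "X + Y" := (vadd X Y) : vfield_scope.
Notation "X - Y" := (vadd X (vscal (-1) Y)) : vfield_scope.
Notation "f ** X" := (vmul f%R X)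
  (at level 40, left associativity) : vfield_scope.
Notation "k *: X" := (vscal k%R X)
  (at level 40, left associativity) : vfield_scope.

Definition partial_t : vfield :=
  VField (fun _ _ _ => 1) (fun _ _ _ => 0) (fun _ _ _ => 0).
Definition infinity_field (b : R -> R -> R) : vfield :=
  VField (fun _ _ _ => 0) (fun _ _ _ => 0) (fun t x _ => b t x).
Definition homogeneous : vfield :=
  VField (fun _ _ _ => 0) (fun _ _ _ => 0) (fun _ _ u => u).
Definition killing (sigma : R -> R) : vfield :=
  VField (fun _ _ _ => 0) (fun _ x _ => sigma x) (fun _ _ _ => 0).
Definition homothetic (sigma y : R -> R) : vfield :=
  VField (fun _ _ _ => 0) (fun _ x _ => sigma x * y x) (fun _ _ _ => 0).

Definition veq_on (I : R -> Prop) (X Y : vfield) : Prop :=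
  forall t x u : R, I x ->
    xi_t X t x u = xi_t Y t x u /\
    xi_x X t x u = xi_x Y t x u /\
    eta X t x u = eta Y t x u.

Definition vzero : vfield :=
  VField (fun _ _ _ => 0) (fun _ _ _ => 0) (fun _ _ _ => 0).

Definition combination (Z0 Z1 Z2 Z3 Z4 : vfield) (k0 k1 k2 k3 k4 h : R)
    (b : R -> R -> R) : vfield :=
  (k0 *: Z0 + k1 *: Z1 + k2 *: Z2 + k3 *: Z3 + k4 *: Z4
   + h *: homogeneous + infinity_field b)%VF.

(* The Lie point symmetries are spanned by the Zi, F d/dF and the b d/dF with b
   a solution, and the first six are linearly independent modulo the last
   family: this is the count 5 + 1 + infinity. *)
Definition symmetries_generated (I : R -> Prop) (E : jet -> R)
    (Z0 Z1 Z2 Z3 Z4 : vfield) : Prop :=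
  lie_symmetry I E Z0 /\ lie_symmetry I E Z1 /\ lie_symmetry I E Z2 /\
  lie_symmetry I E Z3 /\ lie_symmetry I E Z4 /\
  lie_symmetry I E homogeneous /\
  (forall b, solution I E b -> lie_symmetry I E (infinity_field b)) /\
  (forall X, lie_symmetry I E X ->
     exists (k0 k1 k2 k3 k4 h : R) (b : R -> R -> R),
       solution I E b /\
       veq_on I X (combination Z0 Z1 Z2 Z3 Z4 k0 k1 k2 k3 k4 h b)) /\
  (forall (k0 k1 k2 k3 k4 h : R) (b : R -> R -> R),
     solution I E b ->
     veq_on I (combination Z0 Z1 Z2 Z3 Z4 k0 k1 k2 k3 k4 h b) vzero ->
     k0 = 0 /\ k1 = 0 /\ k2 = 0 /\ k3 = 0 /\ k4 = 0 /\ h = 0).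

Definition maximally_symmetric (I : R -> Prop) (E : jet -> R) : Prop :=
  exists Z0 Z1 Z2 Z3 Z4 : vfield, symmetries_generated I E Z0 Z1 Z2 Z3 Z4.

(* Main.v *)
Require Import Defs.
From Stdlib Require Import Reals Lra FunctionalExtensionality.
From Coquelicot Require Import Coquelicot.
(* Makes [d1] denote the partial derivative again: Stdlib's Reals shadows it. *)
Import Defs.
Open Scope R_scope.

(** In the coordinate [y] the equation is [F_t = F_yy / 2 - g F_y] with
    [g = Cx / sigma]. That [T(t) d/dy] is a symmetry means [T' = g' T], so [g']
    is constant and [g = m y + c].

    Splitting the symmetry condition with respect to the jet variables shows that
    every symmetry is [tau(t) d/dt + w d/dy + (phi F + b) d/dF] with [b] a solution,
    [w = tau' y / 2 + alpha(t)], [phi_y = m w - w_t + tau' g / 2] and [phi] a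
    solution. Hence [phi] is a quadratic polynomial in [y], and comparing
    coefficients leaves [tau''' = 4 m^2 tau'], [alpha'' = m^2 alpha + 3/2 m c tau']
    and a first-order equation for the term [delta(t)] of [phi] free of [y]. This
    linear system has a six-dimensional solution space, parametrized by initial
    data at [t = 0]; the listed vectors, with [d/dt] and [F d/dF], are a basis. *)

(** * Smooth functions of (t, x, F) *)

(** The change of coordinate is never carried out: all computations stay in [x], and [y] enters only
    through [y' = 1/sigma], which is why derivatives of [sigma] accompany the identities until
    [field] cancels them. Functions are total and [Derive] has a value everywhere, so many
    identities between partials are available only over [I]; openness of [I] lets them be
    differentiated again in [x], and its being an interval turns a vanishing [x]-derivative into a
    constant. A symmetry must have smooth coefficients, while [y] and the solutions of the linear
    system are known only through the derivatives they satisfy; their regularity is deduced from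
    those equations. Conversely, the functions of t attached to an arbitrary symmetry are read off
    at one base point, where they inherit differentiability from the coefficients. The linear system
    is triangular, so uniqueness reduces to scalar equations with an integrating factor; generation
    and independence then become linear algebra in six unknowns. The case m = c = 0 has no listed
    vectors but still belongs to the claim of maximal symmetry. *)

Lemma open_itv_open (lo hi : Rbar) : open (open_itv lo hi).
Proof.
  apply open_and; [apply open_Rbar_gt | apply open_Rbar_lt].
Qed.

Lemma open_itv_nonempty (lo hi : Rbar) :
  Rbar_lt lo hi -> exists x, open_itv lo hi x.
Proof.
  unfold open_itv; destruct lo as [l| |], hi as [h| |]; simpl; intros Hlt;
    try contradiction.
  - exists ((l + h) / 2); simpl; lra.
  - exists (l + 1); simpl; lra.
  - exists (h - 1); simpl; lra.
  - exists 0; simpl; auto.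
Qed.

Lemma open_itv_const (lo hi : Rbar) (f : R -> R) :
  (forall x, open_itv lo hi x -> is_derive f x 0) ->
  forall x z, open_itv lo hi x -> open_itv lo hi z -> f x = f z.
Proof.
  intros Hf.
  assert (Hlt : forall x z, open_itv lo hi x -> open_itv lo hi z -> x < z -> f x = f z).
  { intros x z [Hx _] [_ Hz] Hxz. apply (@eq_is_derive _ f x z); trivial.
    intros t Ht; apply Hf; split.
    - apply (Rbar_lt_le_trans _ x); simpl; tauto.
    - apply (Rbar_le_lt_trans _ z); simpl; tauto. }
  intros x z Hx Hz; destruct (Rtotal_order x z) as [H|[->|H]]; auto.
  symmetry; auto.
Qed.

Lemma locally_slab (I : R -> Prop) (t x u : R) :
  open I -> I x -> locally (t, x, u) (fun p : R * R * R => I (snd (fst p))).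
Proof.
  intros HI Hx. destruct (HI x Hx) as [e He]. exists e. intros [[t' x'] u'] [[_ H] _].
  apply He, H.
Qed.

(** Differentiation rules hold only where the functions are differentiable, that is over [I]. This
    lemma lets the closure proofs replace a partial derivative by its formula there; openness is
    what makes the replacement legitimate under [d2]. *)
Lemma Ck_ext (I : R -> Prop) (n : nat) (f g : fun3) :
  open I -> (forall t x u, I x -> f t x u = g t x u) -> Ck I n f -> Ck I n g.
Proof.
  intros HI. revert f g. induction n as [|n IH]; intros f g Hfg [Hc Hd].
  all: split; [intros t x u Hx; apply continuous_ext_loc
     with (fun p : R * R * R => f (fst (fst p)) (snd (fst p)) (snd p)); auto;
     apply (filter_imp (fun p : R * R * R => I (snd (fst p))));
     [intros [[? ?] ?]; simpl; auto | now apply locally_slab] | ].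
  - trivial.
  - destruct Hd as [He [H1 [H2 H3]]].
    assert (L : forall t x u, I x -> locally x (fun s => f t s u = g t s u)).
    { intros t x u Hx. apply (filter_imp I); auto. }
    split; [|split; [|split]].
    + intros t x u Hx. destruct (He t x u Hx) as [E1 [E2 E3]]. split; [|split].
      * apply ex_derive_ext with (2 := E1). auto.
      * apply ex_derive_ext_loc with (2 := E2). auto.
      * apply ex_derive_ext with (2 := E3). auto.
    + apply IH with (2 := H1). intros t x u Hx; apply Derive_ext; auto.
    + apply IH with (2 := H2). intros t x u Hx; apply Derive_ext_loc; auto.
    + apply IH with (2 := H3). intros t x u Hx; apply Derive_ext; auto.
Qed.

Lemma Ck_pred (I : R -> Prop) (n : nat) (f : fun3) : Ck I (S n) f -> Ck I n f.
Proof.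
  revert f; induction n as [|n IH]; intros f [Hc [He [H1 [H2 H3]]]].
  - split; auto.
  - split; [exact Hc | split; [exact He | auto]].
Qed.

Lemma Ck_const (I : R -> Prop) (n : nat) (k : R) : Ck I n (fun _ _ _ => k).
Proof.
  revert k; induction n as [|n IH]; intros k.
  all: split; [intros; apply continuous_const | trivial].
  split; [intros; repeat split; apply ex_derive_const|].
  assert (E : d1 (fun _ _ _ => k) = (fun _ _ _ => 0) /\ d2 (fun _ _ _ => k) = (fun _ _ _ => 0)
   /\ d3 (fun _ _ _ => k) = (fun _ _ _ => 0)).
  { repeat split; do 3 (apply functional_extensionality; intro); exact (Derive_const _ _). }
  destruct E as [-> [-> ->]]; auto.
Qed.

Lemma Ck_plus (I : R -> Prop) (n : nat) (f g : fun3) :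
  open I -> Ck I n f -> Ck I n g -> Ck I n (fun t x u => f t x u + g t x u).
Proof.
  intros HI; revert f g; induction n as [|n IH]; intros f g [Fc Fd] [Gc Gd].
  all: split; [intros t x u Hx;
     apply (@continuous_plus _ R_AbsRing R_NormedModule
       (fun p : R * R * R => f (fst (fst p)) (snd (fst p)) (snd p))); auto | trivial].
  destruct Fd as [Fe [F1 [F2 F3]]], Gd as [Ge [G1 [G2 G3]]].
  split; [|split; [|split]].
  - intros t x u Hx; destruct (Fe t x u Hx) as [? [? ?]], (Ge t x u Hx) as [? [? ?]].
    repeat split; apply @ex_derive_plus; auto.
  - apply Ck_ext with (3 := IH _ _ F1 G1); auto.
    intros t x u Hx; unfold d1, d2, d3; rewrite Derive_plus; [reflexivity | |];
      destruct (Fe t x u Hx) as [? [? ?]], (Ge t x u Hx) as [? [? ?]]; assumption.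
  - apply Ck_ext with (3 := IH _ _ F2 G2); auto.
    intros t x u Hx; unfold d1, d2, d3; rewrite Derive_plus; [reflexivity | |];
      destruct (Fe t x u Hx) as [? [? ?]], (Ge t x u Hx) as [? [? ?]]; assumption.
  - apply Ck_ext with (3 := IH _ _ F3 G3); auto.
    intros t x u Hx; unfold d1, d2, d3; rewrite Derive_plus; [reflexivity | |];
      destruct (Fe t x u Hx) as [? [? ?]], (Ge t x u Hx) as [? [? ?]]; assumption.
Qed.

Lemma Ck_mult (I : R -> Prop) (n : nat) (f g : fun3) :
  open I -> Ck I n f -> Ck I n g -> Ck I n (fun t x u => f t x u * g t x u).
Proof.
  intros HI; revert f g; induction n as [|n IH]; intros f g HF HG.
  all: pose proof HF as [Fc Fd]; pose proof HG as [Gc Gd].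
  all: split; [intros t x u Hx;
     apply (@continuous_mult _ R_AbsRing
       (fun p : R * R * R => f (fst (fst p)) (snd (fst p)) (snd p))); auto | trivial].
  destruct Fd as [Fe [F1 [F2 F3]]], Gd as [Ge [G1 [G2 G3]]].
  (* The product rule multiplies a derivative, of order [n], by an undifferentiated factor, which
     has to be lowered to order [n] as well. *)
  apply Ck_pred in HF; apply Ck_pred in HG.
  split; [|split; [|split]].
  - intros t x u Hx; destruct (Fe t x u Hx) as [? [? ?]], (Ge t x u Hx) as [? [? ?]].
    repeat split; apply ex_derive_mult; auto.
  - apply Ck_ext with (3 := Ck_plus _ _ _ _ HI (IH _ _ F1 HG) (IH _ _ HF G1)); auto.
    intros t x u Hx; unfold d1, d2, d3; rewrite Derive_mult; [reflexivity | |];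
      destruct (Fe t x u Hx) as [? [? ?]], (Ge t x u Hx) as [? [? ?]]; assumption.
  - apply Ck_ext with (3 := Ck_plus _ _ _ _ HI (IH _ _ F2 HG) (IH _ _ HF G2)); auto.
    intros t x u Hx; unfold d1, d2, d3; rewrite Derive_mult; [reflexivity | |];
      destruct (Fe t x u Hx) as [? [? ?]], (Ge t x u Hx) as [? [? ?]]; assumption.
  - apply Ck_ext with (3 := Ck_plus _ _ _ _ HI (IH _ _ F3 HG) (IH _ _ HF G3)); auto.
    intros t x u Hx; unfold d1, d2, d3; rewrite Derive_mult; [reflexivity | |];
      destruct (Fe t x u Hx) as [? [? ?]], (Ge t x u Hx) as [? [? ?]]; assumption.
Qed.

Lemma Ck_x (I : R -> Prop) (n : nat) (f : R -> R) :
  smooth_on I f -> Ck I n (fun _ x _ => f x).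
Proof.
  revert f; induction n as [|n IH]; intros f Hf.
  all: split; [intros t x u Hx; apply (continuous_comp (fun p : R * R * R => snd (fst p)) f);
    [apply (continuous_comp (fun p : R * R * R => fst p) snd);
       [apply continuous_fst | apply continuous_snd]
    | apply @ex_derive_continuous; apply (Hf 1%nat); exact Hx] | trivial].
  assert (E : d1 (fun _ x _ => f x) = (fun _ _ _ => 0) /\ d3 (fun _ x _ => f x) = (fun _ _ _ => 0)).
  { repeat split; do 3 (apply functional_extensionality; intro); exact (Derive_const _ _). }
  destruct E as [-> ->].
  split; [|split; [apply Ck_const | split; [|apply Ck_const]]].
  - intros t x u Hx; repeat split; try apply ex_derive_const. apply (Hf 1%nat); exact Hx.
  - apply (IH (Derive f)). intros [|k] x Hx; [exact Logic.I|].
    apply ex_derive_ext with (Derive_n f (S k)); [|apply (Hf (S (S k))); exact Hx].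
    intros z. rewrite <- (Nat.add_1_r k), <- Derive_n_comp. reflexivity.
Qed.

Lemma Ck_inv (I : R -> Prop) (n : nat) (f : fun3) :
  open I -> (forall t x u, I x -> f t x u <> 0) -> Ck I n f ->
  Ck I n (fun t x u => / f t x u).
Proof.
  intros HI H0; induction n as [|n IH]; intros HF; pose proof HF as [Fc Fd].
  all: split; [intros t x u Hx;
     apply (continuous_comp (fun p : R * R * R => f (fst (fst p)) (snd (fst p)) (snd p)) Rinv);
     [auto | simpl; apply continuous_Rinv; auto] | trivial].
  apply Ck_pred, IH in HF.
  destruct Fd as [Fe [F1 [F2 F3]]].
  (* Each partial of 1/f is -f' (1/f)^2, and its factors 1/f have the order already settled by
     induction. *)
  assert (D : forall g, Ck I n g ->
    Ck I n (fun t x u => (-1) * (g t x u * (/ f t x u * / f t x u)))).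
  { intros g Hg. apply (Ck_mult I n (fun _ _ _ => -1)); auto using Ck_const.
    apply Ck_mult; auto. apply Ck_mult; auto. }
  split; [|split; [|split]].
  - intros t x u Hx; destruct (Fe t x u Hx) as [? [? ?]].
    repeat split; apply ex_derive_inv; auto.
  - apply Ck_ext with (3 := D _ F1); auto.
    intros t x u Hx; unfold d1; rewrite Derive_inv; [field | |]; auto;
      destruct (Fe t x u Hx) as [? [? ?]]; assumption.
  - apply Ck_ext with (3 := D _ F2); auto.
    intros t x u Hx; unfold d2; rewrite Derive_inv; [field | |]; auto;
      destruct (Fe t x u Hx) as [? [? ?]]; assumption.
  - apply Ck_ext with (3 := D _ F3); auto.
    intros t x u Hx; unfold d3; rewrite (Derive_inv (fun s => f t x s)); [field | |]; auto;
      destruct (Fe t x u Hx) as [? [? ?]]; assumption.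
Qed.

(** Gives the regularity of [y], whose only known property is its derivative. Over [I] the partial
    [d2 g] is [f], so nothing beyond the class of [f] has to be established. *)
Lemma Ck_antiderivative (I : R -> Prop) (n : nat) (f g : R -> R) :
  open I -> (forall x, I x -> is_derive g x (f x)) ->
  Ck I n (fun _ x _ => f x) -> Ck I n (fun _ x _ => g x).
Proof.
  intros HI Hg; induction n as [|n IH]; intros HF.
  all: split; [intros t x u Hx; apply (continuous_comp (fun p : R * R * R => snd (fst p)) g);
    [apply (continuous_comp (fun p : R * R * R => fst p) snd);
       [apply continuous_fst | apply continuous_snd]
    | apply @ex_derive_continuous; eexists; apply Hg; exact Hx] | trivial].
  assert (E : d1 (fun _ x _ => g x) = (fun _ _ _ => 0) /\ d3 (fun _ x _ => g x) = (fun _ _ _ => 0)).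
  { repeat split; do 3 (apply functional_extensionality; intro); exact (Derive_const _ _). }
  destruct E as [-> ->].
  split; [|split; [apply Ck_const | split; [|apply Ck_const]]].
  - intros t x u Hx; repeat split; try apply ex_derive_const. eexists; apply Hg; exact Hx.
  - apply Ck_ext with (fun _ x _ => f x); auto using Ck_pred.
    intros t x u Hx; symmetry; apply is_derive_unique; auto.
Qed.

Lemma Ck_u (I : R -> Prop) (n : nat) : Ck I n (fun _ _ u => u).
Proof.
  destruct n as [|n].
  all: split; [intros t x u Hx; apply continuous_snd | trivial].
  assert (E : d1 (fun _ _ u => u) = (fun _ _ _ => 0) /\ d2 (fun _ _ u => u) = (fun _ _ _ => 0)
   /\ d3 (fun _ _ u => u) = (fun _ _ _ => 1)).
  { repeat split; do 3 (apply functional_extensionality; intro);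
     [exact (Derive_const _ _) | exact (Derive_const _ _) | exact (Derive_id _)]. }
  destruct E as [-> [-> ->]].
  split; [|auto using Ck_const].
  intros; repeat split; try apply ex_derive_const; apply ex_derive_id.
Qed.

(** Applied at F = 0, this makes the two coefficients of a component affine in F smooth functions of
    (t, x). *)
Lemma Ck_slice (I : R -> Prop) (n : nat) (f : fun3) (v : R) :
  Ck I n f -> Ck I n (fun t x _ => f t x v).
Proof.
  revert f; induction n as [|n IH]; intros f [Hc Hd].
  all: split; [intros t x u Hx P HP; destruct (Hc t x v Hx P HP) as [e He];
     exists e; intros p [Hp _]; apply (He (fst p, v));
     split; [exact Hp | apply ball_center] | trivial].
  destruct Hd as [He [H1 [H2 H3]]].
  split; [|split; [|split]].
  - intros t x u Hx; destruct (He t x v Hx) as [? [? ?]].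
    repeat split; auto. apply ex_derive_const.
  - apply (IH _ H1).
  - apply (IH _ H2).
  - replace (d3 (fun t x _ => f t x v)) with (fun _ _ _ : R => 0); [apply Ck_const|].
    do 3 (apply functional_extensionality; intro); symmetry; exact (Derive_const _ _).
Qed.

(** * Second prolongation and determining equations *)

Ltac eta_reduce :=
  repeat match goal with
  | |- context [fun x : R => ?f x] => progress change (fun x : R => f x) with f
  end.

Lemma Dt_lift (f : fun3) (j : jet) :
  Dt (lift f) j = lift (d1 f) j + j c_ut * lift (d3 f) j.
Proof.
  unfold Dt.
  change (pd c_ut (lift f) j) with (Derive (fun _ => lift f j) (j c_ut)).
  change (pd c_ux (lift f) j) with (Derive (fun _ => lift f j) (j c_ux)).
  rewrite !Derive_const.
  change (pd c_t (lift f) j) with (lift (d1 f) j).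
  change (pd c_u (lift f) j) with (lift (d3 f) j). ring.
Qed.

Lemma Dx_lift (f : fun3) (j : jet) :
  Dx (lift f) j = lift (d2 f) j + j c_ux * lift (d3 f) j.
Proof.
  unfold Dx.
  change (pd c_ut (lift f) j) with (Derive (fun _ => lift f j) (j c_ut)).
  change (pd c_ux (lift f) j) with (Derive (fun _ => lift f j) (j c_ux)).
  rewrite !Derive_const.
  change (pd c_x (lift f) j) with (lift (d2 f) j).
  change (pd c_u (lift f) j) with (lift (d3 f) j). ring.
Qed.

(** The second total x-derivative of a function of (t, x, F). The two mixed partials are kept in the
    order in which they arise. *)
Definition Dxx (f : fun3) (j : jet) : R :=
  lift (d2 (d2 f)) j + j c_ux * (lift (d3 (d2 f)) j + lift (d2 (d3 f)) j)
  + j c_ux ^ 2 * lift (d3 (d3 f)) j + j c_uxx * lift (d3 f) j.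

Lemma eta_x_lift (X : vfield) (j : jet) :
  eta_x X j =
  lift (d2 (eta X)) j + j c_ux * lift (d3 (eta X)) j
  - j c_ut * (lift (d2 (xi_t X)) j + j c_ux * lift (d3 (xi_t X)) j)
  - j c_ux * (lift (d2 (xi_x X)) j + j c_ux * lift (d3 (xi_x X)) j).
Proof. unfold eta_x; rewrite !Dx_lift; reflexivity. Qed.

(** The differentiated expression is [eta_x] with F_t and F_x frozen; the lemma serves for its
    derivative along x and for its derivative along F. *)
Lemma Derive_jet_expression (n2 n3 t2 t3 x2 x3 : R -> R) (ut ux s : R) :
  ex_derive n2 s -> ex_derive n3 s -> ex_derive t2 s -> ex_derive t3 s ->
  ex_derive x2 s -> ex_derive x3 s ->
  Derive (fun s => n2 s + ux * n3 s - ut * (t2 s + ux * t3 s)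
                   - ux * (x2 s + ux * x3 s)) s =
  Derive n2 s + ux * Derive n3 s - ut * (Derive t2 s + ux * Derive t3 s)
  - ux * (Derive x2 s + ux * Derive x3 s).
Proof.
  intros. apply is_derive_unique; auto_derive; [tauto | eta_reduce; ring].
Qed.

(** Each factor 2 collects one term from differentiating the explicit F_t or F_x in [eta_x] and one
    equal term subtracted in the definition of [eta_xx]. *)
Lemma eta_xx_lift (I : R -> Prop) (X : vfield) (j : jet) :
  smooth3 I (xi_t X) -> smooth3 I (xi_x X) -> smooth3 I (eta X) -> I (j c_x) ->
  eta_xx X j =
  Dxx (eta X) j - j c_ut * Dxx (xi_t X) j - j c_ux * Dxx (xi_x X) j
  - 2 * j c_utx * (lift (d2 (xi_t X)) j + j c_ux * lift (d3 (xi_t X)) j)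
  - 2 * j c_uxx * (lift (d2 (xi_x X)) j + j c_ux * lift (d3 (xi_x X)) j).
Proof.
  intros HT HX HN Hj. unfold eta_xx; rewrite !Dx_lift.
  replace (eta_x X) with (fun j => lift (d2 (eta X)) j + j c_ux * lift (d3 (eta X)) j
    - j c_ut * (lift (d2 (xi_t X)) j + j c_ux * lift (d3 (xi_t X)) j)
    - j c_ux * (lift (d2 (xi_x X)) j + j c_ux * lift (d3 (xi_x X)) j))
    by (apply functional_extensionality; intros; symmetry; apply eta_x_lift).
  destruct X as [T X N]; simpl in *.
  destruct (HT 2%nat) as [_ [_ [_ [T2 T3]]]].
  destruct (HX 2%nat) as [_ [_ [_ [X2 X3]]]].
  destruct (HN 2%nat) as [_ [_ [_ [N2 N3]]]].
  destruct T2 as [_ [T2 _]], T3 as [_ [T3 _]], X2 as [_ [X2 _]],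
    X3 as [_ [X3 _]], N2 as [_ [N2 _]], N3 as [_ [N3 _]].
  specialize (T2 (j c_t) (j c_x) (j c_u) Hj) as [_ [T2x T2u]].
  specialize (T3 (j c_t) (j c_x) (j c_u) Hj) as [_ [T3x T3u]].
  specialize (X2 (j c_t) (j c_x) (j c_u) Hj) as [_ [X2x X2u]].
  specialize (X3 (j c_t) (j c_x) (j c_u) Hj) as [_ [X3x X3u]].
  specialize (N2 (j c_t) (j c_x) (j c_u) Hj) as [_ [N2x N2u]].
  specialize (N3 (j c_t) (j c_x) (j c_u) Hj) as [_ [N3x N3u]].
  unfold Dx, pd, lift; simpl.
  unfold upd; simpl.
  set (t := j c_t) in *; set (x := j c_x) in *; set (u := j c_u) in *.
  set (ut := j c_ut) in *; set (ux := j c_ux) in *.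
  rewrite (Derive_jet_expression (fun s => d2 N t s u) (fun s => d3 N t s u)
    (fun s => d2 T t s u) (fun s => d3 T t s u)
    (fun s => d2 X t s u) (fun s => d3 X t s u)) by assumption.
  rewrite (Derive_jet_expression (fun s => d2 N t x s) (fun s => d3 N t x s)
    (fun s => d2 T t x s) (fun s => d3 T t x s)
    (fun s => d2 X t x s) (fun s => d3 X t x s)) by assumption.
  rewrite (is_derive_unique _ ut (- (d2 T t x u + ux * d3 T t x u)))
    by (auto_derive; [trivial | ring]).
  rewrite (is_derive_unique _ ux (d3 N t x u - ut * d3 T t x u
      - (d2 X t x u + 2 * ux * d3 X t x u)))
    by (auto_derive; [trivial | ring]).
  unfold Dxx, lift. fold t x u ux.
  change (Derive (fun s => d2 N t s u) x) with (d2 (d2 N) t x u).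
  change (Derive (fun s => d3 N t s u) x) with (d2 (d3 N) t x u).
  change (Derive (fun s => d2 T t s u) x) with (d2 (d2 T) t x u).
  change (Derive (fun s => d3 T t s u) x) with (d2 (d3 T) t x u).
  change (Derive (fun s => d2 X t s u) x) with (d2 (d2 X) t x u).
  change (Derive (fun s => d3 X t s u) x) with (d2 (d3 X) t x u).
  change (Derive (fun s => d2 N t x s) u) with (d3 (d2 N) t x u).
  change (Derive (fun s => d3 N t x s) u) with (d3 (d3 N) t x u).
  change (Derive (fun s => d2 T t x s) u) with (d3 (d2 T) t x u).
  change (Derive (fun s => d3 T t x s) u) with (d3 (d3 T) t x u).
  change (Derive (fun s => d2 X t x s) u) with (d3 (d2 X) t x u).
  change (Derive (fun s => d3 X t x s) u) with (d3 (d3 X) t x u).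
  ring.
Qed.

(** The equation contains x, F_x, F_t and F_xx but not t, F, F_tt or F_tx, so only [xi_x], [eta_t],
    [eta_x] and [eta_xx] contribute. *)
Lemma prolong2_equation (I : R -> Prop) (sigma Cx : R -> R) (X : vfield) (j : jet) :
  smooth_on I sigma -> smooth_on I Cx ->
  smooth3 I (xi_t X) -> smooth3 I (xi_x X) -> smooth3 I (eta X) -> I (j c_x) ->
  let s := sigma (j c_x) in
  let s' := Derive sigma (j c_x) in
  let s'' := Derive (Derive sigma) (j c_x) in
  let ux := j c_ux in
  let ut := j c_ut in
  prolong2 X (equation sigma Cx) j =
  lift (xi_x X) j * (s * s' * j c_uxx
     + (/ 2 * (s' ^ 2 + s * s'') - Derive Cx (j c_x)) * ux)
  - (lift (d1 (eta X)) j + ut * lift (d3 (eta X)) j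
     - ut * (lift (d1 (xi_t X)) j + ut * lift (d3 (xi_t X)) j)
     - ux * (lift (d1 (xi_x X)) j + ut * lift (d3 (xi_x X)) j))
  + (/ 2 * s * s' - Cx (j c_x)) *
    (lift (d2 (eta X)) j + ux * lift (d3 (eta X)) j
     - ut * (lift (d2 (xi_t X)) j + ux * lift (d3 (xi_t X)) j)
     - ux * (lift (d2 (xi_x X)) j + ux * lift (d3 (xi_x X)) j))
  + / 2 * s ^ 2 *
    (Dxx (eta X) j - ut * Dxx (xi_t X) j - ux * Dxx (xi_x X) j
     - 2 * j c_utx * (lift (d2 (xi_t X)) j + ux * lift (d3 (xi_t X)) j)
     - 2 * j c_uxx * (lift (d2 (xi_x X)) j + ux * lift (d3 (xi_x X)) j)).
Proof.
  intros Hs HC HT HX HN Hj s s' s'' ux ut.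
  assert (E1 := Hs 1%nat _ Hj). assert (E2 := Hs 2%nat _ Hj). assert (E3 := HC 1%nat _ Hj).
  simpl in E1, E2, E3. change (fun x => Derive (fun x0 => sigma x0) x) with (Derive sigma) in E2.
  unfold prolong2. rewrite (eta_xx_lift I) by assumption. rewrite eta_x_lift.
  unfold eta_t at 1. rewrite !Dt_lift.
  assert (Pt : pd c_t (equation sigma Cx) j = 0).
  { apply is_derive_unique; unfold equation, laplace_jet, upd; simpl; auto_derive; trivial. }
  assert (Pu : pd c_u (equation sigma Cx) j = 0).
  { apply is_derive_unique; unfold equation, laplace_jet, upd; simpl; auto_derive; trivial. }
  assert (Putt : pd c_utt (equation sigma Cx) j = 0).
  { apply is_derive_unique; unfold equation, laplace_jet, upd; simpl; auto_derive; trivial. }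
  assert (Putx : pd c_utx (equation sigma Cx) j = 0).
  { apply is_derive_unique; unfold equation, laplace_jet, upd; simpl; auto_derive; trivial. }
  assert (Put : pd c_ut (equation sigma Cx) j = -1).
  { apply is_derive_unique; unfold equation, laplace_jet, upd; simpl; auto_derive; trivial; ring. }
  assert (Pux : pd c_ux (equation sigma Cx) j = / 2 * s * s' - Cx (j c_x)).
  { apply is_derive_unique; unfold equation, laplace_jet, upd; simpl; auto_derive; trivial.
    subst s s'; eta_reduce; ring. }
  assert (Puxx : pd c_uxx (equation sigma Cx) j = / 2 * s ^ 2).
  { apply is_derive_unique; unfold equation, laplace_jet, upd; simpl; auto_derive; trivial.
    subst s; ring. }
  assert (Px : pd c_x (equation sigma Cx) j = s * s' * j c_uxx
     + (/ 2 * (s' ^ 2 + s * s'') - Derive Cx (j c_x)) * ux).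
  { apply is_derive_unique; unfold equation, laplace_jet, upd; simpl; auto_derive.
    - repeat split; assumption.
    - subst s s' s'' ux. eta_reduce. field. }
  rewrite Pt, Pu, Putt, Putx, Put, Pux, Puxx, Px.
  fold ut ux. ring.
Qed.

Lemma partials_ext (I : R -> Prop) (f g : fun3) :
  open I -> (forall t x u, I x -> f t x u = g t x u) ->
  forall t x u, I x ->
  d1 f t x u = d1 g t x u /\ d2 f t x u = d2 g t x u /\ d3 f t x u = d3 g t x u.
Proof.
  intros HI Hf t x u Hx; split; [|split].
  - apply Derive_ext; auto.
  - apply Derive_ext_loc, (filter_imp I); auto.
  - apply Derive_ext; auto.
Qed.

Lemma partials_eq0 (I : R -> Prop) (f : fun3) :
  open I -> (forall t x u, I x -> f t x u = 0) ->
  forall t x u, I x -> d1 f t x u = 0 /\ d2 f t x u = 0 /\ d3 f t x u = 0.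
Proof.
  intros HI Hf t x u Hx.
  destruct (partials_ext I f (fun _ _ _ => 0) HI Hf t x u Hx) as (-> & -> & ->).
  repeat split; exact (Derive_const _ _).
Qed.

Lemma slice_const (I : R -> Prop) (f : fun3) :
  Ck I 1 f -> (forall t x u, I x -> d3 f t x u = 0) ->
  forall t x u v, I x -> f t x u = f t x v.
Proof.
  intros [_ [Hf _]] H0 t x u v Hx.
  apply (open_itv_const m_infty p_infty (f t x)); try (split; exact Logic.I).
  intros w _. rewrite <- (H0 t x w Hx). apply Derive_correct.
  destruct (Hf t x w Hx) as [_ [_ H]]; exact H.
Qed.

(** Solving the equation for F_t parametrizes its solution set by the remaining coordinates. The
    prolonged equation does not contain F_tt, and the value 0 for it is arbitrary. *)
Definition solution_jet (sigma Cx : R -> R) (t x u ux utx uxx : R) : jet := fun c =>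
  match c with
  | c_t => t
  | c_x => x
  | c_u => u
  | c_ut => / 2 * sigma x ^ 2 * uxx + (/ 2 * sigma x * Derive sigma x - Cx x) * ux
  | c_ux => ux
  | c_utt => 0
  | c_utx => utx
  | c_uxx => uxx
  end.

Lemma equation_solution_jet (sigma Cx : R -> R) (t x u ux utx uxx : R) :
  equation sigma Cx (solution_jet sigma Cx t x u ux utx uxx) = 0.
Proof. unfold equation, laplace_jet; simpl; ring. Qed.

Lemma sqr_mult_eq0 (s a : R) : s <> 0 -> s ^ 2 * a = 0 -> a = 0.
Proof.
  intros Hs H; destruct (Rmult_integral _ _ H) as [H'|H']; trivial.
  exfalso; revert H'; apply pow_nonzero; exact Hs.
Qed.

(** On the solution set the condition is polynomial in F_x, F_tx and F_xx. Its coefficients are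
    extracted by evaluating at a few jets with entries 0, 1 and -1; each coefficient found to vanish
    is differentiated and substituted back before the next one is extracted. *)
Lemma determining_equations (I : R -> Prop) (sigma Cx : R -> R) (T X N : fun3) :
  open I -> smooth_on I sigma -> smooth_on I Cx ->
  (forall x, I x -> sigma x <> 0) ->
  lie_symmetry I (equation sigma Cx) (VField T X N) ->
  forall t x u, I x ->
  let s := sigma x in
  let s' := Derive sigma x in
  let s'' := Derive (Derive sigma) x in
  let beta := / 2 * s * s' - Cx x in
  let beta' := / 2 * (s' ^ 2 + s * s'') - Derive Cx x in
  d2 T t x u = 0 /\ d3 T t x u = 0 /\ d3 X t x u = 0 /\ d3 (d3 N) t x u = 0 /\
  X t x u * (s * s') + / 2 * s ^ 2 * d1 T t x u = s ^ 2 * d2 X t x u /\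
  X t x u * beta' + beta * d1 T t x u + d1 X t x u - beta * d2 X t x u
    + / 2 * s ^ 2 * (d3 (d2 N) t x u + d2 (d3 N) t x u - d2 (d2 X) t x u) = 0 /\
  d1 N t x u = beta * d2 N t x u + / 2 * s ^ 2 * d2 (d2 N) t x u.
Proof.
  intros HI Hs HC Hs0 [HT [HX [HN HP]]]; simpl in HT, HX, HN.
  assert (P : forall t x u ux utx uxx, I x -> prolong2 (VField T X N) (equation sigma Cx)
     (solution_jet sigma Cx t x u ux utx uxx) = 0).
  { intros t x u ux utx uxx Hx; apply HP; [exact Hx | apply equation_solution_jet]. }
  clear HP.
  (* The conclusion is left as a hole, to be filled by whatever the rewriting of the prolongation
     produces. *)
  assert (Q : forall t x u ux utx uxx, I x -> _) by
   (intros t x u ux utx uxx Hx; generalize (P t x u ux utx uxx Hx);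
    rewrite (prolong2_equation I) by assumption; intros Q; exact Q).
  clear P; unfold Dxx, lift in Q; simpl in Q.
  (* F_tx enters linearly, with coefficient -sigma^2 (T_x + F_x T_F). Two jets differing only in
     F_tx isolate it: F_x = 0 yields T_x, and then F_x = 1 yields T_F. *)
  assert (T2 : forall t x u, I x -> d2 T t x u = 0).
  { intros t x u Hx; apply (sqr_mult_eq0 (sigma x)); auto.
    assert (Q0 := Q t x u 0 0 0 Hx); assert (Q1 := Q t x u 0 1 0 Hx). simpl. lra. }
  assert (T3 : forall t x u, I x -> d3 T t x u = 0).
  { intros t x u Hx; apply (sqr_mult_eq0 (sigma x)); auto.
    assert (Q0 := Q t x u 1 0 0 Hx); assert (Q1 := Q t x u 1 1 0 Hx). simpl.
    rewrite T2 in Q0, Q1 by assumption. lra. }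
  assert (Q' : forall t x u ux uxx, I x -> _) by
   (intros t x u ux uxx Hx; generalize (Q t x u ux 0 uxx Hx);
    destruct (partials_eq0 I (d2 T) HI T2 t x u Hx) as [_ [-> ->]];
    destruct (partials_eq0 I (d3 T) HI T3 t x u Hx) as [_ [-> ->]];
    rewrite (T2 t x u Hx), (T3 t x u Hx); intros Q'; exact Q'); clear Q.
  (* The coefficient of F_x F_xx is -sigma^2 X_F; the mixed difference over four jets extracts
     it. *)
  assert (X3 : forall t x u, I x -> d3 X t x u = 0).
  { intros t x u Hx; apply (sqr_mult_eq0 (sigma x)); auto.
    assert (Q0 := Q' t x u 0 0 Hx); assert (Q1 := Q' t x u 0 1 Hx);
    assert (Q2 := Q' t x u 1 0 Hx); assert (Q3 := Q' t x u 1 1 Hx). simpl. lra. }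
  (* Differentiating [X3] gives the mixed partial in the other order only; this one vanishes because
     X itself is independent of F. *)
  assert (X23 : forall t x u, I x -> d3 (d2 X) t x u = 0).
  { intros t x u Hx. unfold d3 at 1.
    rewrite (Derive_ext _ (fun _ => d2 X t x 0)); [apply Derive_const|].
    intros v. apply Derive_ext_loc, (filter_imp I); auto.
    intros z Hz. apply (slice_const I X); auto. }
  assert (Q : forall t x u ux uxx, I x -> _) by
   (intros t x u ux uxx Hx; generalize (Q' t x u ux uxx Hx);
    destruct (partials_eq0 I (d3 X) HI X3 t x u Hx) as [_ [-> ->]];
    rewrite (X23 t x u Hx), (X3 t x u Hx); intros Q; exact Q); clear Q'.
  intros t x u Hx; simpl.
  (* At F_xx = 0 the condition is now quadratic in F_x, and the values 0, 1, -1 separate its three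
     coefficients; the fourth jet gives the coefficient of F_xx. *)
  assert (Q0 := Q t x u 0 0 Hx); assert (Q1 := Q t x u 1 0 Hx);
  assert (Q2 := Q t x u (-1) 0 Hx); assert (Q3 := Q t x u 0 1 Hx).
  assert (N33 : d3 (d3 N) t x u = 0).
  { apply (sqr_mult_eq0 (sigma x)); auto. simpl; lra. }
  rewrite N33 in Q1. repeat split; auto; lra.
Qed.

(** * Symmetries as solutions of a linear system *)

(* Phase space of the system for [tau], [alpha] and [delta]: [tau1], [tau2] and
   [alpha1] stand for [tau'], [tau''] and [alpha']. *)
Record state := State { tau : R -> R; tau1 : R -> R; tau2 : R -> R;
                        alpha : R -> R; alpha1 : R -> R; delta : R -> R }.

(** Write phi = P y^2 + Q y + delta with P = (m tau' - tau''/2)/2 and Q = m alpha - alpha' + c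
    tau'/2. Then phi is a solution exactly when P' = -2 m P, Q' = -m Q - 2 c P and delta' = P - c Q;
    these are the third, fifth and sixth lines. *)
Definition flow (m c : R) (s : state) : Prop := forall t,
  is_derive (tau s) t (tau1 s t) /\
  is_derive (tau1 s) t (tau2 s t) /\
  is_derive (tau2 s) t (4 * m ^ 2 * tau1 s t) /\
  is_derive (alpha s) t (alpha1 s t) /\
  is_derive (alpha1 s) t (m ^ 2 * alpha s t + 3 / 2 * m * c * tau1 s t) /\
  is_derive (delta s) t ((m * tau1 s t - tau2 s t / 2) / 2
     - c * (m * alpha s t - alpha1 s t + c * tau1 s t / 2)).

Definition field_of (sigma y : R -> R) (m c : R) (s : state) : vfield :=
  VField (fun t _ _ => tau s t)
    (fun t x _ => sigma x * (tau1 s t / 2 * y x + alpha s t))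
    (fun t x u => ((m * tau1 s t - tau2 s t / 2) / 2 * y x ^ 2
       + (m * alpha s t - alpha1 s t + c * tau1 s t / 2) * y x + delta s t) * u).

Definition null_at (s : state) (t : R) : Prop :=
  tau s t = 0 /\ tau1 s t = 0 /\ tau2 s t = 0 /\ alpha s t = 0 /\ alpha1 s t = 0 /\ delta s t = 0.

Lemma derive0_const (f : R -> R) : (forall t, is_derive f t 0) -> forall t, f t = f 0.
Proof.
  intros Hf t. apply (open_itv_const m_infty p_infty); try (split; exact Logic.I). auto.
Qed.

Lemma linear_ode1 (k : R) (f : R -> R) :
  (forall t, is_derive f t (k * f t)) -> f 0 = 0 -> forall t, f t = 0.
Proof.
  intros Hf H0 t.
  assert (E : forall t, f t * exp (- (k * t)) = f 0 * exp (- (k * 0))).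
  { apply (derive0_const (fun t => f t * exp (- (k * t)))). intros z.
    assert (D := is_derive_unique _ _ _ (Hf z)).
    auto_derive; [eexists; apply Hf | eta_reduce; rewrite D; ring]. }
  specialize (E t). rewrite H0, Rmult_0_l in E.
  destruct (Rmult_integral _ _ E) as [E'|E']; trivial.
  exfalso; generalize (exp_pos (- (k * t))); lra.
Qed.

(** The equation f'' = k^2 f factors: g - k f satisfies a first-order equation with rate -k, and
    once it vanishes f satisfies one with rate k. The argument covers k = 0. *)
Lemma linear_ode2 (k : R) (f g : R -> R) :
  (forall t, is_derive f t (g t)) -> (forall t, is_derive g t (k ^ 2 * f t)) ->
  f 0 = 0 -> g 0 = 0 -> forall t, f t = 0 /\ g t = 0.
Proof.
  intros Hf Hg F0 G0.
  assert (E : forall t, g t - k * f t = 0).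
  { apply (linear_ode1 (- k) (fun t => g t - k * f t)); [|rewrite F0, G0; ring]. intros z.
    assert (Df := is_derive_unique _ _ _ (Hf z)); assert (Dg := is_derive_unique _ _ _ (Hg z)).
    auto_derive; [split; [|split; trivial]; eexists; auto | eta_reduce; rewrite Df, Dg; ring]. }
  assert (F : forall t, f t = 0).
  { apply (linear_ode1 k); trivial. intros t. replace (k * f t) with (g t); auto.
    specialize (E t); lra. }
  intros t; split; trivial. specialize (E t); rewrite (F t) in E; lra.
Qed.

(** The system is triangular: the pair [tau1], [tau2] is closed with rate 2m; once it vanishes the
    pair [alpha], [alpha1] is closed with rate m; then [tau] and [delta] have zero derivative. *)
Lemma flow_unique (m c : R) (s : state) :
  flow m c s -> null_at s 0 -> forall t, null_at s t.
Proof.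
  intros Hs (Z & Z1 & Z2 & Za & Za1 & Zd).
  assert (E : forall t, tau1 s t = 0 /\ tau2 s t = 0).
  { apply (linear_ode2 (2 * m)); trivial; intros t; destruct (Hs t) as (H & H1 & H2 & _); trivial.
    replace ((2 * m) ^ 2 * tau1 s t) with (4 * m ^ 2 * tau1 s t) by ring; trivial. }
  assert (Ea : forall t, alpha s t = 0 /\ alpha1 s t = 0).
  { apply (linear_ode2 m); trivial; intros t; destruct (Hs t) as (_ & _ & _ & H & H1 & _); trivial.
    destruct (E t) as [E1 _]; rewrite E1 in H1.
    replace (m ^ 2 * alpha s t) with (m ^ 2 * alpha s t + 3 / 2 * m * c * 0) by ring; trivial. }
  intros t; destruct (E t) as [E1 E2]; destruct (Ea t) as [Ea1 Ea2].
  repeat split; trivial.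
  - rewrite <- Z. apply derive0_const. intros z; destruct (Hs z) as (H & _).
    destruct (E z) as [<- _]; trivial.
  - rewrite <- Zd. apply derive0_const. intros z; destruct (Hs z) as (_ & _ & _ & _ & _ & H).
    destruct (E z) as [F1 F2]; destruct (Ea z) as [F3 F4]; rewrite F1, F2, F3, F4 in H.
    match type of H with is_derive _ _ ?v => replace 0 with v by field end; trivial.
Qed.

Definition state_plus (s r : state) : state :=
  State (fun t => tau s t + tau r t) (fun t => tau1 s t + tau1 r t)
    (fun t => tau2 s t + tau2 r t) (fun t => alpha s t + alpha r t)
    (fun t => alpha1 s t + alpha1 r t) (fun t => delta s t + delta r t).

Definition state_scal (k : R) (s : state) : state :=
  State (fun t => k * tau s t) (fun t => k * tau1 s t) (fun t => k * tau2 s t)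
    (fun t => k * alpha s t) (fun t => k * alpha1 s t) (fun t => k * delta s t).

Lemma flow_plus (m c : R) (s r : state) :
  flow m c s -> flow m c r -> flow m c (state_plus s r).
Proof.
  intros Hs Hr t. destruct (Hs t) as (S1 & S2 & S3 & S4 & S5 & S6).
  destruct (Hr t) as (R1 & R2 & R3 & R4 & R5 & R6). unfold state_plus; simpl.
  refine (conj _ (conj _ (conj _ (conj _ (conj _ _))))).
  all: match goal with |- is_derive (fun z => ?f z + ?g z) ?z0 ?v =>
    match goal with H : is_derive f z0 ?a, H' : is_derive g z0 ?b |- _ =>
      replace v with (a + b) by (simpl; field); exact (is_derive_plus f g z0 a b H H') end end.
Qed.

Lemma flow_scal (m c k : R) (s : state) : flow m c s -> flow m c (state_scal k s).
Proof.
  intros Hs t. destruct (Hs t) as (S1 & S2 & S3 & S4 & S5 & S6).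
  unfold state_scal; simpl.
  refine (conj _ (conj _ (conj _ (conj _ (conj _ _))))).
  all: match goal with |- is_derive (fun z => ?q * ?f z) ?z0 ?v =>
    match goal with H : is_derive f z0 ?a |- _ =>
      replace v with (q * a) by (simpl; field); exact (is_derive_scal f z0 q a H) end end.
Qed.

(** Linear combinations of the six components are closed under differentiation, so the induction has
    to treat all of them at once; [D] computes the new coefficients. *)
Lemma flow_Ck (I : R -> Prop) (m c : R) (s : state) : flow m c s ->
  forall n k0 k1 k2 k3 k4 k5, Ck I n (fun t _ _ => k0 * tau s t + k1 * tau1 s t
    + k2 * tau2 s t + k3 * alpha s t + k4 * alpha1 s t + k5 * delta s t).
Proof.
  intros Hs.
  assert (D : forall k0 k1 k2 k3 k4 k5 t, is_derive (fun t => k0 * tau s t + k1 * tau1 s t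
    + k2 * tau2 s t + k3 * alpha s t + k4 * alpha1 s t + k5 * delta s t) t
    (0 * tau s t + (k0 + 4 * m ^ 2 * k2 + 3 / 2 * m * c * k4 + (m / 2 - c ^ 2 / 2) * k5) * tau1 s t
    + (k1 - k5 / 4) * tau2 s t + (m ^ 2 * k4 - c * m * k5) * alpha s t
    + (k3 + c * k5) * alpha1 s t + 0 * delta s t)).
  { intros. destruct (Hs t) as (S1 & S2 & S3 & S4 & S5 & S6).
    assert (U1 := is_derive_unique _ _ _ S1); assert (U2 := is_derive_unique _ _ _ S2);
    assert (U3 := is_derive_unique _ _ _ S3); assert (U4 := is_derive_unique _ _ _ S4);
    assert (U5 := is_derive_unique _ _ _ S5); assert (U6 := is_derive_unique _ _ _ S6).
    auto_derive; [repeat split; eexists; eassumption|].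
    eta_reduce. rewrite U1, U2, U3, U4, U5, U6. field. }
  induction n as [|n IH]; intros.
  all: match goal with |- Ck ?J ?l (fun t _ _ => @?f t) =>
    set (g := f); change (Ck J l (fun t _ _ => g t)) end.
  all: split; [intros t x u Hx; apply (continuous_comp (fun p : R * R * R => fst (fst p)) g);
    [apply (continuous_comp (fun p : R * R * R => fst p) fst); apply continuous_fst
    | apply @ex_derive_continuous; eexists; apply D] | trivial].
  assert (E : d2 (fun t _ _ => g t) = (fun _ _ _ => 0) /\ d3 (fun t _ _ => g t) = (fun _ _ _ => 0)).
  { repeat split; do 3 (apply functional_extensionality; intro); exact (Derive_const _ _). }
  destruct E as [-> ->].
  split; [|split; [|split; apply Ck_const]].
  - intros t x u Hx; refine (conj _ (conj (ex_derive_const _ _) (ex_derive_const _ _))).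
    eexists; apply D.
  - refine (eq_ind _ (Ck I n) (IH _ _ _ _ _ _) _ _).
    do 3 (apply functional_extensionality; intro). symmetry. apply is_derive_unique, D.
Qed.

(** * From solutions of the linear system to symmetries *)

Definition linear_drift (I : R -> Prop) (sigma Cx y : R -> R) (m c : R) : Prop :=
  open I /\ smooth_on I sigma /\ (forall x, I x -> sigma x <> 0) /\ smooth_on I Cx /\
  (forall x, I x -> is_derive y x (/ sigma x)) /\
  (forall x, I x -> Cx x = m * sigma x * y x + c * sigma x).

Lemma smooth_antiderivative_inv (I : R -> Prop) (sigma y : R -> R) :
  open I -> smooth_on I sigma -> (forall x, I x -> sigma x <> 0) ->
  (forall x, I x -> is_derive y x (/ sigma x)) -> smooth3 I (fun _ x _ => y x).
Proof.
  intros HI Hs H0 Hy n. apply (Ck_antiderivative I n (fun x => / sigma x)); auto.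
  apply (Ck_inv I n (fun _ x _ => sigma x)); auto. apply Ck_x, Hs.
Qed.

Lemma field_of_smooth (I : R -> Prop) (sigma Cx y : R -> R) (m c : R) (s : state) :
  linear_drift I sigma Cx y m c -> flow m c s ->
  smooth3 I (xi_t (field_of sigma y m c s)) /\
  smooth3 I (xi_x (field_of sigma y m c s)) /\
  smooth3 I (eta (field_of sigma y m c s)).
Proof.
  intros (HI & Hs & H0 & HC & Hy & _) Hf.
  assert (Y := smooth_antiderivative_inv I sigma y HI Hs H0 Hy).
  assert (S := flow_Ck I m c s Hf).
  unfold field_of; cbn [xi_t xi_x eta].
  split; [|split]; intros n.
  - apply Ck_ext with (3 := S n 1 0 0 0 0 0); auto. intros; ring.
  - apply Ck_mult; auto. { apply Ck_x, Hs. }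
    apply Ck_ext with (3 := Ck_plus I n _ _ HI
      (Ck_mult I n _ _ HI (S n 0 (/ 2) 0 0 0 0) (Y n)) (S n 0 0 0 1 0 0)); auto.
    intros; field.
  - apply Ck_mult; auto; [|apply Ck_u].
    apply Ck_ext with (3 := Ck_plus I n _ _ HI
      (Ck_mult I n _ _ HI (S n 0 (m / 2) (- / 4) 0 0 0) (Ck_mult I n _ _ HI (Y n) (Y n)))
      (Ck_plus I n _ _ HI (Ck_mult I n _ _ HI (S n 0 (c / 2) 0 m (-1) 0) (Y n))
         (S n 0 0 0 0 0 1))); auto.
    intros; field.
Qed.

Lemma Derive_drift (I : R -> Prop) (sigma Cx y : R -> R) (m c : R) :
  linear_drift I sigma Cx y m c -> forall x, I x ->
  Derive Cx x = m * Derive sigma x * y x + m + c * Derive sigma x.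
Proof.
  intros (HI & Hs & H0 & HC & Hy & HCy) x Hx.
  rewrite (Derive_ext_loc _ (fun x => m * sigma x * y x + c * sigma x)).
  - assert (U := is_derive_unique _ _ _ (Hy x Hx)). apply is_derive_unique. auto_derive.
    + refine (conj (Hs 1%nat x Hx) (conj _ (conj (Hs 1%nat x Hx) Logic.I))). eexists; apply Hy, Hx.
    + eta_reduce. rewrite U. field. auto.
  - apply (filter_imp I); auto.
Qed.

Lemma field_of_symmetry (I : R -> Prop) (sigma Cx y : R -> R) (m c : R) (s : state) :
  linear_drift I sigma Cx y m c -> flow m c s ->
  lie_symmetry I (equation sigma Cx) (field_of sigma y m c s).
Proof.
  intros Hou Hf. destruct (field_of_smooth I sigma Cx y m c s Hou Hf) as (ST & SX & SN).
  pose proof Hou as (HI & Hs & H0 & HC & Hy & HCy).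
  refine (conj ST (conj SX (conj SN _))). intros j Hj Ej.
  rewrite (prolong2_equation I) by assumption.
  assert (DC := Derive_drift I sigma Cx y m c Hou).
  set (P := fun t => (m * tau1 s t - tau2 s t / 2) / 2).
  set (Q := fun t => m * alpha s t - alpha1 s t + c * tau1 s t / 2).
  set (T := xi_t (field_of sigma y m c s)) in *.
  set (X := xi_x (field_of sigma y m c s)) in *.
  set (N := eta (field_of sigma y m c s)) in *.
  assert (Tt : forall t x u, d1 T t x u = tau1 s t).
  { intros; apply is_derive_unique, Hf. }
  assert (T2 : forall t x u, I x -> d2 T t x u = 0) by (intros; exact (Derive_const _ _)).
  assert (T3 : forall t x u, I x -> d3 T t x u = 0) by (intros; exact (Derive_const _ _)).
  assert (Xt : forall t x u, d1 X t x u = sigma x * (tau2 s t / 2 * y x + alpha1 s t)).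
  { intros t x u; destruct (Hf t) as (_ & S2 & _ & S4 & _).
    assert (U2 := is_derive_unique _ _ _ S2); assert (U4 := is_derive_unique _ _ _ S4).
    apply is_derive_unique. unfold X, field_of; cbn [xi_x]. auto_derive.
    - refine (conj _ (conj _ Logic.I)); eexists; eassumption.
    - eta_reduce. rewrite U2, U4; field. }
  assert (X2 : forall t x u, I x -> d2 X t x u =
     Derive sigma x * (tau1 s t / 2 * y x + alpha s t) + tau1 s t / 2).
  { intros t x u Hx. assert (U := is_derive_unique _ _ _ (Hy x Hx)).
    apply is_derive_unique. unfold X, field_of; cbn [xi_x]. auto_derive.
    - refine (conj (Hs 1%nat x Hx) (conj _ Logic.I)); eexists; apply Hy, Hx.
    - eta_reduce. rewrite U; field; auto. }
  assert (X22 : forall t x u, I x -> d2 (d2 X) t x u =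
     Derive (Derive sigma) x * (tau1 s t / 2 * y x + alpha s t)
     + Derive sigma x * tau1 s t / (2 * sigma x)).
  { intros t x u Hx. destruct (partials_ext I _ _ HI X2 t x u Hx) as (_ & -> & _).
    assert (U := is_derive_unique _ _ _ (Hy x Hx)).
    apply is_derive_unique. auto_derive.
    - refine (conj (Hs 2%nat x Hx) (conj _ Logic.I)); eexists; apply Hy, Hx.
    - eta_reduce. rewrite U; field; auto. }
  assert (X3 : forall t x u, I x -> d3 X t x u = 0) by (intros; exact (Derive_const _ _)).
  assert (X32 : forall t x u, I x -> d3 (d2 X) t x u = 0)
    by (intros; exact (Derive_const (d2 X t x u) u)).
  (* Among the partials computed here, only this one uses the evolution of [tau2], [alpha1] and
     [delta]; it makes the coefficient of F a solution. *)
  assert (Nt : forall t x u, d1 N t x u =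
    ((m * tau2 s t / 2 - m ^ 2 * tau1 s t) * y x ^ 2
     + (m * alpha1 s t - m ^ 2 * alpha s t - 3 / 2 * m * c * tau1 s t + c * tau2 s t / 2) * y x
     + (P t - c * Q t)) * u).
  { intros t x u; destruct (Hf t) as (_ & S2 & S3 & S4 & S5 & S6).
    assert (U2 := is_derive_unique _ _ _ S2); assert (U4 := is_derive_unique _ _ _ S4);
    assert (U3 := is_derive_unique _ _ _ S3); assert (U5 := is_derive_unique _ _ _ S5);
    assert (U6 := is_derive_unique _ _ _ S6).
    apply is_derive_unique. unfold N, field_of; cbn [eta]. auto_derive.
    - repeat (refine (conj _ _) || exact Logic.I); eexists; eassumption.
    - eta_reduce. rewrite U2, U3, U4, U5, U6. unfold P, Q. field. }
  assert (N2 : forall t x u, I x -> d2 N t x u = (2 * P t * y x + Q t) / sigma x * u).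
  { intros t x u Hx. assert (U := is_derive_unique _ _ _ (Hy x Hx)).
    apply is_derive_unique. unfold N, field_of; cbn [eta]. auto_derive.
    - repeat (refine (conj _ _) || exact Logic.I); eexists; apply Hy, Hx.
    - eta_reduce. rewrite U; unfold P, Q; field; auto. }
  assert (N3 : forall t x u, d3 N t x u = P t * y x ^ 2 + Q t * y x + delta s t).
  { intros t x u. apply is_derive_unique. unfold N, field_of; cbn [eta]. auto_derive; trivial.
    unfold P, Q; ring. }
  assert (N22 : forall t x u, I x -> d2 (d2 N) t x u =
    (2 * P t - (2 * P t * y x + Q t) * Derive sigma x) / sigma x ^ 2 * u).
  { intros t x u Hx. destruct (partials_ext I _ _ HI N2 t x u Hx) as (_ & -> & _).
    assert (U := is_derive_unique _ _ _ (Hy x Hx)).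
    apply is_derive_unique. auto_derive.
    - refine (conj _ (conj (Hs 1%nat x Hx) (conj (H0 x Hx) Logic.I))); eexists; apply Hy, Hx.
    - eta_reduce. rewrite U; field; auto. }
  assert (N32 : forall t x u, I x -> d3 (d2 N) t x u = (2 * P t * y x + Q t) / sigma x).
  { intros t x u Hx. destruct (partials_ext I _ _ HI N2 t x u Hx) as (_ & _ & ->).
    apply is_derive_unique. auto_derive; trivial. field; auto. }
  assert (N23 : forall t x u, I x -> d2 (d3 N) t x u = (2 * P t * y x + Q t) / sigma x).
  { intros t x u Hx.
    destruct (partials_ext I _ (fun t x _ => P t * y x ^ 2 + Q t * y x + delta s t) HI
      (fun t x u _ => N3 t x u) t x u Hx) as (_ & -> & _).
    assert (U := is_derive_unique _ _ _ (Hy x Hx)).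
    apply is_derive_unique. auto_derive.
    - repeat (refine (conj _ _) || exact Logic.I); eexists; apply Hy, Hx.
    - eta_reduce. rewrite U; field; auto. }
  assert (N33 : forall t x u, d3 (d3 N) t x u = 0).
  { intros t x u. rewrite <- (Derive_const (P t * y x ^ 2 + Q t * y x + delta s t) u).
    apply Derive_ext; auto. }
  set (t := j c_t) in *; set (x := j c_x) in *; set (u := j c_u) in *.
  change (xi_t (field_of sigma y m c s)) with T.
  change (xi_x (field_of sigma y m c s)) with X.
  change (eta (field_of sigma y m c s)) with N.
  unfold Dxx, lift. fold t x u.
  destruct (partials_eq0 I (d2 T) HI T2 t x u Hj) as (_ & -> & ->).
  destruct (partials_eq0 I (d3 T) HI T3 t x u Hj) as (_ & -> & ->).
  destruct (partials_eq0 I (d3 X) HI X3 t x u Hj) as (_ & -> & ->).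
  rewrite (T2 t x u Hj), (T3 t x u Hj), (X3 t x u Hj), (X32 t x u Hj), (X2 t x u Hj),
    (X22 t x u Hj), (N2 t x u Hj), (N22 t x u Hj), (N32 t x u Hj), (N23 t x u Hj),
    N33, N3, Nt, Xt, Tt, (DC x Hj), (HCy x Hj).
  (* The only use of the assumption that the jet lies on the solution set: F_t is eliminated. *)
  assert (Eut : j c_ut = / 2 * sigma x ^ 2 * j c_uxx
    + (/ 2 * sigma x * Derive sigma x - (m * sigma x * y x + c * sigma x)) * j c_ux).
  { unfold equation, laplace_jet in Ej. fold x in Ej. rewrite (HCy x Hj) in Ej. lra. }
  rewrite Eut. unfold X, field_of, P, Q; cbn [xi_x]. field. auto.
Qed.

(** The equation is linear, so prolonging b d/dF and applying it to the equation gives the equation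
    evaluated at the jet of b, at whatever point of the fibre [j] lies. *)
Lemma infinity_field_symmetry (I : R -> Prop) (sigma Cx : R -> R) (b : R -> R -> R) :
  open I -> smooth_on I sigma -> smooth_on I Cx ->
  solution I (equation sigma Cx) b ->
  lie_symmetry I (equation sigma Cx) (infinity_field b).
Proof.
  intros HI Hs HC [Sb Eb].
  assert (SZ : smooth3 I (fun _ _ _ => 0)) by (intros n; apply Ck_const).
  refine (conj SZ (conj SZ (conj Sb _))). intros j Hj _.
  rewrite (prolong2_equation I) by assumption.
  unfold infinity_field; cbn [xi_t xi_x eta].
  assert (Z : forall t x u, d1 (fun _ _ _ => 0) t x u = 0 /\ d2 (fun _ _ _ => 0) t x u = 0
    /\ d3 (fun _ _ _ => 0) t x u = 0)
    by (intros; repeat split; exact (Derive_const _ _)).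
  assert (N3 : forall t x u, I x -> d3 (fun t x _ => b t x) t x u = 0)
    by (intros; exact (Derive_const _ _)).
  specialize (Eb (j c_t) (j c_x) Hj).
  set (t := j c_t) in *; set (x := j c_x) in *; set (u := j c_u) in *.
  unfold Dxx, lift. fold t x u.
  destruct (partials_eq0 I _ HI N3 t x u Hj) as (_ & -> & ->).
  destruct (Z t x u) as (-> & Z2 & Z3).
  destruct (partials_eq0 I (d2 (fun _ _ _ => 0)) HI (fun t x u _ => proj1 (proj2 (Z t x u)))
    t x u Hj) as (_ & -> & ->).
  destruct (partials_eq0 I (d3 (fun _ _ _ => 0)) HI (fun t x u _ => proj2 (proj2 (Z t x u)))
    t x u Hj) as (_ & -> & ->).
  rewrite Z2, Z3, (N3 t x u Hj).
  replace (d3 (d2 (fun t x _ => b t x)) t x u) with 0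
    by (symmetry; exact (Derive_const (Derive (fun z => b t z) x) u)).
  unfold equation, laplace_jet, jet_of in Eb.
  change (Derive (fun s => b s x) t) with (d1 (fun t x _ => b t x) t x u) in Eb.
  change (Derive (fun z => b t z) x) with (d2 (fun t x _ => b t x) t x u) in Eb.
  change (Derive (fun z => Derive (fun w => b t w) z) x)
    with (d2 (d2 (fun t x _ => b t x)) t x u) in Eb.
  lra.
Qed.

(** * From symmetries to solutions of the linear system *)

(** Since y' = 1/sigma never vanishes, it can be divided out of the differentiated identity; two
    rounds bring the degree in [y] down to zero. This justifies comparing coefficients of powers of
    [y]. *)
Lemma quadratic_eq0 (I : R -> Prop) (sigma y : R -> R) (k0 k1 k2 : R) :
  open I -> (exists x, I x) -> (forall x, I x -> sigma x <> 0) ->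
  (forall x, I x -> is_derive y x (/ sigma x)) ->
  (forall x, I x -> k2 * y x ^ 2 + k1 * y x + k0 = 0) -> k0 = 0 /\ k1 = 0 /\ k2 = 0.
Proof.
  intros HI [x0 Hx0] H0 Hy HQ.
  assert (D : forall l0 l1 l2, (forall x, I x -> l2 * y x ^ 2 + l1 * y x + l0 = 0) ->
     forall x, I x -> 0 * y x ^ 2 + 2 * l2 * y x + l1 = 0).
  { intros l0 l1 l2 H x Hx.
    assert (Z : Derive (fun x => l2 * y x ^ 2 + l1 * y x + l0) x = 0).
    { rewrite (Derive_ext_loc _ (fun _ => 0)); [apply Derive_const|].
      apply (filter_imp I); auto. }
    assert (U := is_derive_unique _ _ _ (Hy x Hx)).
    rewrite (is_derive_unique _ x ((0 * y x ^ 2 + 2 * l2 * y x + l1) * / sigma x)) in Z.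
    - destruct (Rmult_integral _ _ Z) as [H1|H1]; trivial.
      destruct (Rinv_neq_0_compat _ (H0 x Hx) H1).
    - auto_derive.
      + repeat (refine (conj _ _) || exact Logic.I); eexists; apply Hy, Hx.
      + eta_reduce; rewrite U; field; auto. }
  assert (D1 := D _ _ _ HQ); assert (D2 := D _ _ _ D1).
  specialize (HQ x0 Hx0); specialize (D1 x0 Hx0); specialize (D2 x0 Hx0).
  assert (k2 = 0) by lra. subst k2.
  assert (k1 = 0) by lra. subst k1. repeat split; lra.
Qed.

Lemma symmetry_form (lo hi : Rbar) (sigma Cx y : R -> R) (m c : R) (V : vfield) :
  let I := open_itv lo hi in
  Rbar_lt lo hi -> linear_drift I sigma Cx y m c ->
  lie_symmetry I (equation sigma Cx) V ->
  exists s b, flow m c s /\ solution I (equation sigma Cx) b /\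
    veq_on I V (field_of sigma y m c s + infinity_field b)%VF.
Proof.
  intros I Hne Hou HV. pose proof Hou as (HI & Hs & H0 & HC & Hy & HCy).
  destruct (open_itv_nonempty _ _ Hne) as [x0 Hx0].
  destruct V as [T X N].
  assert (DE := determining_equations I sigma Cx T X N HI Hs HC H0 HV).
  destruct HV as (ST & SX & SN & _); cbn [xi_t xi_x eta] in ST, SX, SN.
  assert (ET : forall t x u, I x -> T t x u = T t x0 0).
  { intros t x u Hx. rewrite (slice_const I T (ST 1%nat)) with (v := 0); trivial;
      [|intros; apply DE; trivial].
    apply (open_itv_const lo hi (fun z => T t z 0)); trivial.
    intros z Hz. destruct (DE t z 0 Hz) as (E & _).
    destruct (ST 1%nat) as (_ & ex & _); destruct (ex t z 0 Hz) as (_ & e & _).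
    refine (eq_ind _ (is_derive _ z) (Derive_correct _ _ e) _ E). }
  assert (EX : forall t x u, I x -> X t x u = X t x 0).
  { intros t x u Hx. apply (slice_const I X (SX 1%nat)); trivial. intros; apply DE; trivial. }
  assert (EA : forall t x u, I x -> d3 N t x u = d3 N t x 0).
  { intros t x u Hx. apply (slice_const I (d3 N)); trivial; [|intros; apply DE; trivial].
    destruct (SN 2%nat) as (_ & _ & _ & _ & S3); exact S3. }
  assert (EN : forall t x u, I x -> N t x u = d3 N t x 0 * u + N t x 0).
  { intros t x u Hx.
    assert (Z : N t x u - d3 N t x 0 * u = N t x 0 - d3 N t x 0 * 0).
    { apply (derive0_const (fun u => N t x u - d3 N t x 0 * u)). intros v.
      destruct (SN 1%nat) as (_ & ex & _); destruct (ex t x v Hx) as (_ & _ & e).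
      auto_derive; [exact e |].
      change (Derive (fun s => N t x s) v) with (d3 N t x v). rewrite EA by trivial. ring. }
    lra. }
  (* The components of the state are defined by values at [x0] and F = 0, so their derivatives in t
     are partials of smooth coefficients. That the choice of point is immaterial is shown
     afterwards. *)
  set (T1 := fun t => d1 T t x0 0). set (T2 := fun t => d1 (d1 T) t x0 0).
  set (T3 := fun t => d1 (d1 (d1 T)) t x0 0).
  set (a := fun t => X t x0 0 / sigma x0 - T1 t / 2 * y x0).
  set (a1 := fun t => d1 X t x0 0 / sigma x0 - T2 t / 2 * y x0).
  set (a2 := fun t => d1 (d1 X) t x0 0 / sigma x0 - T3 t / 2 * y x0).
  assert (D1T : forall t, is_derive (fun t => T t x0 0) t (T1 t)).
  { intros t. destruct (ST 1%nat) as (_ & ex & _). apply Derive_correct, (ex t x0 0 Hx0). }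
  assert (D2T : forall t, is_derive T1 t (T2 t)).
  { intros t. destruct (ST 2%nat) as (_ & _ & (_ & ex & _) & _). apply Derive_correct, (ex t x0 0 Hx0). }
  assert (D3T : forall t, is_derive T2 t (T3 t)).
  { intros t. destruct (ST 3%nat) as (_ & _ & (_ & _ & (_ & ex & _) & _) & _).
    apply Derive_correct, (ex t x0 0 Hx0). }
  assert (Da : forall t, is_derive a t (a1 t)).
  { intros t. destruct (SX 1%nat) as (_ & ex & _). destruct (ex t x0 0 Hx0) as (e & _).
    assert (U := is_derive_unique _ _ _ (D2T t)). unfold a, a1. auto_derive.
    - refine (conj _ (conj _ Logic.I)); [exact e | eexists; apply D2T].
    - eta_reduce. rewrite U. unfold d1; field. auto. }
  assert (Da1 : forall t, is_derive a1 t (a2 t)).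
  { intros t. destruct (SX 2%nat) as (_ & _ & (_ & ex & _) & _). destruct (ex t x0 0 Hx0) as (e & _).
    assert (U := is_derive_unique _ _ _ (D3T t)). unfold a1, a2. auto_derive.
    - refine (conj _ (conj _ Logic.I)); [exact e | eexists; apply D3T].
    - eta_reduce. rewrite U. change (Derive (fun t => d1 X t x0 0) t) with (d1 (d1 X) t x0 0).
      field. auto. }
  assert (DT : forall t x u, I x -> d1 T t x u = T1 t).
  { intros t x u Hx. destruct (partials_ext I T (fun t _ _ => T t x0 0) HI ET t x u Hx) as (-> & _).
    reflexivity. }
  assert (FX : forall t x u, I x -> X t x u = sigma x * (T1 t / 2 * y x + a t)).
  { intros t x u Hx. rewrite EX by trivial.
    assert (Z : X t x 0 / sigma x - T1 t / 2 * y x = a t).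
    { apply (open_itv_const lo hi (fun x => X t x 0 / sigma x - T1 t / 2 * y x)); trivial.
      (* The fifth determining equation says that the x-derivative of X/sigma is tau'/(2 sigma),
         that is tau'/2 times y'. *)
      intros z Hz. destruct (DE t z 0 Hz) as (_ & _ & _ & _ & E & _).
      rewrite DT in E by trivial.
      destruct (SX 1%nat) as (_ & ex & _). destruct (ex t z 0 Hz) as (_ & e & _).
      assert (U := is_derive_unique _ _ _ (Hy z Hz)). auto_derive.
      - refine (conj e (conj (Hs 1%nat z Hz) (conj (H0 z Hz) (conj _ Logic.I)))).
        eexists; apply Hy, Hz.
      - eta_reduce. rewrite U. change (Derive (fun x => X t x 0) z) with (d2 X t z 0).
        apply (Rmult_eq_reg_l (sigma z ^ 2)); [|apply pow_nonzero; auto].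
        rewrite Rmult_0_r.
        transitivity (sigma z ^ 2 * d2 X t z 0 / sigma z - X t z 0 * Derive sigma z
          - T1 t / 2 * sigma z); [field; auto|].
        rewrite <- E; field; auto. }
    rewrite <- Z; field; auto. }
  assert (X1 : forall t x u, I x -> d1 X t x u = sigma x * (T2 t / 2 * y x + a1 t)).
  { intros t x u Hx.
    destruct (partials_ext I _ (fun t x _ => sigma x * (T1 t / 2 * y x + a t)) HI FX t x u Hx)
      as (-> & _).
    assert (U := is_derive_unique _ _ _ (D2T t)); assert (U' := is_derive_unique _ _ _ (Da t)).
    apply is_derive_unique. auto_derive.
    - refine (conj _ (conj _ Logic.I)); eexists; auto.
    - eta_reduce. rewrite U, U'; field. }
  assert (X2 : forall t x u, I x -> d2 X t x u =
     Derive sigma x * (T1 t / 2 * y x + a t) + T1 t / 2).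
  { intros t x u Hx.
    destruct (partials_ext I _ (fun t x _ => sigma x * (T1 t / 2 * y x + a t)) HI FX t x u Hx)
      as (_ & -> & _).
    assert (U := is_derive_unique _ _ _ (Hy x Hx)).
    apply is_derive_unique. auto_derive.
    - refine (conj (Hs 1%nat x Hx) (conj _ Logic.I)); eexists; apply Hy, Hx.
    - eta_reduce. rewrite U; field; auto. }
  assert (X22 : forall t x u, I x -> d2 (d2 X) t x u =
     Derive (Derive sigma) x * (T1 t / 2 * y x + a t)
     + Derive sigma x * T1 t / (2 * sigma x)).
  { intros t x u Hx. destruct (partials_ext I _ _ HI X2 t x u Hx) as (_ & -> & _).
    assert (U := is_derive_unique _ _ _ (Hy x Hx)).
    apply is_derive_unique. auto_derive.
    - refine (conj (Hs 2%nat x Hx) (conj _ Logic.I)); eexists; apply Hy, Hx.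
    - eta_reduce. rewrite U; field; auto. }
  (* [A] is the coefficient phi of F in N, given a dummy third argument so that the calculus of
     partials applies to it; [B] below is the part of N free of F. *)
  set (A := fun t x (u : R) => d3 N t x 0).
  assert (SA : smooth3 I A).
  { intros n. apply (Ck_slice I n (d3 N)). destruct (SN (S n)) as (_ & _ & _ & _ & S3); exact S3. }
  set (B := fun t x => N t x 0).
  assert (SB : smooth3 I (fun t x _ => B t x)).
  { intros n; apply (Ck_slice I n N); apply SN. }
  assert (EB : solution I (equation sigma Cx) B).
  { split; trivial. intros t x Hx. destruct (DE t x 0 Hx) as (_ & _ & _ & _ & _ & _ & E).
    unfold equation, laplace_jet, jet_of, B.
    change (Derive (fun s => N s x 0) t) with (d1 N t x 0).
    change (Derive (fun z => N t z 0) x) with (d2 N t x 0).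
    change (Derive (fun z => Derive (fun w => N t w 0) z) x) with (d2 (d2 N) t x 0).
    lra. }
  assert (ENs : forall t x u, I x -> d1 N t x u = d1 A t x 0 * u + d1 N t x 0 /\
      d2 N t x u = d2 A t x 0 * u + d2 N t x 0).
  { intros t x u Hx.
    destruct (partials_ext I _ (fun t x u => A t x 0 * u + N t x 0) HI EN t x u Hx)
      as (-> & -> & _).
    destruct (SA 1%nat) as (_ & exA & _); destruct (exA t x 0 Hx) as (e1 & e2 & _).
    destruct (SN 1%nat) as (_ & exN & _); destruct (exN t x 0 Hx) as (e3 & e4 & _).
    split; apply is_derive_unique; auto_derive.
    - refine (conj e1 (conj e3 Logic.I)).
    - unfold d1; ring.
    - refine (conj e2 (conj e4 Logic.I)).
    - unfold d2; ring. }
  assert (EN22 : forall t x u, I x -> d2 (d2 N) t x u = d2 (d2 A) t x 0 * u + d2 (d2 N) t x 0).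
  { intros t x u Hx.
    destruct (partials_ext I _ (fun t x u => d2 A t x 0 * u + d2 N t x 0) HI
       (fun t x u Hx => proj2 (ENs t x u Hx)) t x u Hx) as (_ & -> & _).
    destruct (SA 2%nat) as (_ & _ & _ & (_ & exA & _) & _); destruct (exA t x 0 Hx) as (_ & e2 & _).
    destruct (SN 2%nat) as (_ & _ & _ & (_ & exN & _) & _); destruct (exN t x 0 Hx) as (_ & e4 & _).
    apply is_derive_unique; auto_derive.
    - refine (conj e2 (conj e4 Logic.I)).
    - unfold d2; ring. }
  assert (EN32 : forall t x u, I x -> d3 (d2 N) t x u = d2 A t x 0).
  { intros t x u Hx.
    destruct (partials_ext I _ (fun t x u => d2 A t x 0 * u + d2 N t x 0) HI
       (fun t x u Hx => proj2 (ENs t x u Hx)) t x u Hx) as (_ & _ & ->).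
    apply is_derive_unique; auto_derive; [trivial | ring]. }
  assert (EN23 : forall t x u, I x -> d2 (d3 N) t x u = d2 A t x 0).
  { intros t x u Hx. destruct (partials_ext I (d3 N) A HI EA t x u Hx) as (_ & -> & _).
    reflexivity. }
  assert (DC := Derive_drift I sigma Cx y m c Hou).
  set (P := fun t => (m * T1 t - T2 t / 2) / 2).
  set (Q := fun t => m * a t - a1 t + c * T1 t / 2).
  (* Both mixed partials of N equal [d2 A], so the sixth determining equation can be solved for
     it. *)
  assert (A2 : forall t x u, I x -> d2 A t x u = (2 * P t * y x + Q t) / sigma x).
  { intros t x u Hx. destruct (DE t x u Hx) as (_ & _ & _ & _ & _ & E & _).
    rewrite EN32, EN23, FX, DT, X1, X2, X22, DC, (HCy x Hx) in E by trivial.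
    change (d2 A t x u) with (d2 A t x 0).
    apply (Rmult_eq_reg_l (sigma x ^ 2)); [|apply pow_nonzero; auto].
    match type of E with ?l = 0 => transitivity (sigma x ^ 2 * d2 A t x 0 - l); [lra|] end.
    unfold P, Q; field; auto. }
  assert (A22 : forall t x u, I x -> d2 (d2 A) t x u =
    (2 * P t - (2 * P t * y x + Q t) * Derive sigma x) / sigma x ^ 2).
  { intros t x u Hx. destruct (partials_ext I _ _ HI A2 t x u Hx) as (_ & -> & _).
    assert (U := is_derive_unique _ _ _ (Hy x Hx)).
    apply is_derive_unique. auto_derive.
    - refine (conj _ (conj (Hs 1%nat x Hx) (conj (H0 x Hx) Logic.I))); eexists; apply Hy, Hx.
    - eta_reduce. rewrite U; field; auto. }
  set (d := fun t => A t x0 0 - P t * y x0 ^ 2 - Q t * y x0).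
  assert (FA : forall t x u, I x -> A t x u = P t * y x ^ 2 + Q t * y x + d t).
  { intros t x u Hx. change (A t x u) with (A t x 0).
    assert (Z : A t x 0 - P t * y x ^ 2 - Q t * y x = d t).
    { apply (open_itv_const lo hi (fun x => A t x 0 - P t * y x ^ 2 - Q t * y x)); trivial.
      intros z Hz. assert (E := A2 t z 0 Hz).
      destruct (SA 1%nat) as (_ & ex & _). destruct (ex t z 0 Hz) as (_ & e & _).
      assert (U := is_derive_unique _ _ _ (Hy z Hz)). auto_derive.
      - refine (conj e (conj _ (conj _ Logic.I))); eexists; apply Hy, Hz.
      - eta_reduce. rewrite U. change (Derive (fun x => A t x 0) z) with (d2 A t z 0).
        rewrite E. field; auto. }
    lra. }
  set (P' := fun t => (m * T2 t - T3 t / 2) / 2).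
  set (Q' := fun t => m * a1 t - a2 t + c * T2 t / 2).
  set (d' := fun t => d1 A t x0 0 - P' t * y x0 ^ 2 - Q' t * y x0).
  assert (DP : forall t, is_derive P t (P' t)).
  { intros t. assert (U := is_derive_unique _ _ _ (D2T t)).
    assert (U' := is_derive_unique _ _ _ (D3T t)). unfold P, P'. auto_derive.
    - refine (conj _ (conj _ Logic.I)); eexists; auto.
    - eta_reduce. rewrite U, U'; field. }
  assert (DQ : forall t, is_derive Q t (Q' t)).
  { intros t. assert (U := is_derive_unique _ _ _ (D2T t)).
    assert (U1 := is_derive_unique _ _ _ (Da t)).
    assert (U2 := is_derive_unique _ _ _ (Da1 t)). unfold Q, Q'. auto_derive.
    - refine (conj _ (conj _ (conj _ Logic.I))); eexists; auto.
    - eta_reduce. rewrite U, U1, U2; field. }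
  assert (Dd : forall t, is_derive d t (d' t)).
  { intros t. assert (U := is_derive_unique _ _ _ (DP t)).
    assert (U1 := is_derive_unique _ _ _ (DQ t)).
    destruct (SA 1%nat) as (_ & ex & _). destruct (ex t x0 0 Hx0) as (e & _).
    unfold d, d'. auto_derive.
    - refine (conj e (conj _ (conj _ Logic.I))); eexists; auto.
    - eta_reduce. rewrite U, U1. change (Derive (fun t => A t x0 0) t) with (d1 A t x0 0). ring. }
  assert (A1 : forall t x u, I x -> d1 A t x u = P' t * y x ^ 2 + Q' t * y x + d' t).
  { intros t x u Hx.
    destruct (partials_ext I _ (fun t x _ => P t * y x ^ 2 + Q t * y x + d t) HI FA t x u Hx)
      as (-> & _).
    assert (U := is_derive_unique _ _ _ (DP t)); assert (U1 := is_derive_unique _ _ _ (DQ t)).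
    assert (U2 := is_derive_unique _ _ _ (Dd t)).
    apply is_derive_unique. auto_derive.
    - refine (conj _ (conj _ (conj _ Logic.I))); eexists; auto.
    - eta_reduce. rewrite U, U1, U2; ring. }
  assert (ODE : forall t, d' t + c * Q t - P t = 0 /\ Q' t + m * Q t + 2 * c * P t = 0 /\
     P' t + 2 * m * P t = 0).
  { intros t. apply (quadratic_eq0 I sigma y); trivial; [exists x0; trivial|].
    intros x Hx.
    (* The last determining equation is affine in F. Its values at F = 1 and F = 0 differ by the
       equation for [A], which is then a quadratic identity in [y]. *)
    destruct (DE t x 0 Hx) as (_ & _ & _ & _ & _ & _ & E0).
    destruct (DE t x 1 Hx) as (_ & _ & _ & _ & _ & _ & E1).
    destruct (ENs t x 1 Hx) as [F1 F2].
    rewrite F1, F2, (EN22 t x 1 Hx) in E1.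
    assert (E : d1 A t x 0 - (/ 2 * sigma x * Derive sigma x - Cx x) * d2 A t x 0
      - / 2 * sigma x ^ 2 * d2 (d2 A) t x 0 = 0) by lra.
    rewrite A1, A2, A22, (HCy x Hx) in E by trivial.
    rewrite <- E. field; auto. }
  exists (State (fun t => T t x0 0) T1 T2 a a1 d), B. split; [|split; trivial].
  - intros t; cbn [tau tau1 tau2 alpha alpha1 delta].
    destruct (ODE t) as (O1 & O2 & O3). unfold P', Q', P, Q in O1, O2, O3.
    refine (conj (D1T t) (conj (D2T t) (conj _ (conj (Da t) (conj _ _))))).
    + refine (eq_ind _ (is_derive _ t) (D3T t) _ _). lra.
    + refine (eq_ind _ (is_derive _ t) (Da1 t) _ _). lra.
    + refine (eq_ind _ (is_derive _ t) (Dd t) _ _). lra.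
  - intros t x u Hx. unfold field_of, infinity_field, vadd; cbn.
    split; [|split].
    + rewrite (ET t x u Hx); ring.
    + rewrite (FX t x u Hx); ring.
    + rewrite (EN t x u Hx). change (d3 N t x 0) with (A t x 0). rewrite (FA t x 0 Hx).
      unfold B, P, Q; ring.
Qed.

(** * The drift forced by the Killing symmetry *)

(** At the single instant [t0] the sixth determining equation becomes (Cx/sigma)' = m y' with m =
    T'(t0)/T(t0). Hence Cx/sigma - m y is constant on the interval, and c is its value. *)
Lemma drift_of_killing (lo hi : Rbar) (sigma Cx y T : R -> R) (t0 : R) :
  let I := open_itv lo hi in
  Rbar_lt lo hi -> smooth_on I sigma -> (forall x, I x -> sigma x <> 0) ->
  smooth_on I Cx -> (forall x, I x -> is_derive y x (/ sigma x)) -> T t0 <> 0 ->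
  lie_symmetry I (equation sigma Cx) ((fun t _ _ => T t) ** killing sigma)%VF ->
  exists m c, forall x, I x -> Cx x = m * sigma x * y x + c * sigma x.
Proof.
  intros I Hne Hs H0 HC Hy HT HK.
  assert (HI : open I) by apply open_itv_open.
  destruct (open_itv_nonempty _ _ Hne) as [x0 Hx0].
  assert (DE := determining_equations I sigma Cx (fun t _ _ => T t * 0) (fun t x _ => T t * sigma x)
    (fun t _ _ => T t * 0) HI Hs HC H0 HK).
  set (m := Derive T t0 / T t0). exists m, (Cx x0 / sigma x0 - m * y x0).
  assert (Z : forall x, I x -> Cx x / sigma x - m * y x = Cx x0 / sigma x0 - m * y x0).
  { intros x Hx. apply (open_itv_const lo hi (fun x => Cx x / sigma x - m * y x)); trivial.
    intros z Hz. destruct (DE t0 z 0 Hz) as (_ & _ & _ & _ & _ & E & _).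
    assert (S0 : forall t x u : R, I x -> T t * 0 = 0) by (intros; ring).
    destruct (partials_eq0 I (fun t _ _ => T t * 0) HI S0 t0 z 0 Hz) as (E1 & _).
    destruct (partials_eq0 I (d2 (fun t _ _ => T t * 0)) HI
      (fun t x u Hx => proj1 (proj2 (partials_eq0 I _ HI S0 t x u Hx))) t0 z 0 Hz) as (_ & _ & E2).
    destruct (partials_eq0 I (d3 (fun t _ _ => T t * 0)) HI
      (fun t x u Hx => proj2 (proj2 (partials_eq0 I _ HI S0 t x u Hx))) t0 z 0 Hz) as (_ & E3 & _).
    rewrite E1, E2, E3 in E.
    replace (d1 (fun t x _ => T t * sigma x) t0 z 0) with (Derive T t0 * sigma z) in E
      by (symmetry; exact (Derive_scal_l T (sigma z) t0)).
    assert (X2 : forall t x u, d2 (fun t x _ => T t * sigma x) t x u = T t * Derive sigma x)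
      by (intros t v u; exact (Derive_scal sigma (T t) v)).
    replace (d2 (d2 (fun t x _ => T t * sigma x)) t0 z 0)
      with (T t0 * Derive (Derive sigma) z) in E.
    2: { rewrite <- Derive_scal. apply Derive_ext; intros; symmetry; apply X2. }
    rewrite X2 in E.
    assert (U := is_derive_unique _ _ _ (Hy z Hz)). auto_derive.
    - refine (conj (HC 1%nat z Hz) (conj (Hs 1%nat z Hz) (conj (H0 z Hz) (conj _ Logic.I)))).
      eexists; apply Hy, Hz.
    - eta_reduce. rewrite U.
      apply (Rmult_eq_reg_l (T t0 * sigma z ^ 2));
        [|apply Rmult_integral_contrapositive; split; [|apply pow_nonzero]; auto].
      rewrite Rmult_0_r. match type of E with ?l = 0 => transitivity (- l); [|lra] end.
      unfold m; field; auto. }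
  intros x Hx. rewrite <- (Z x Hx); field; auto.
Qed.

(** * Generation and independence from initial values *)

Lemma vfield_ext (V W : vfield) :
  (forall t x u, xi_t V t x u = xi_t W t x u) ->
  (forall t x u, xi_x V t x u = xi_x W t x u) ->
  (forall t x u, eta V t x u = eta W t x u) -> V = W.
Proof.
  destruct V, W; cbn; intros H1 H2 H3.
  f_equal; do 3 (apply functional_extensionality; intro); auto.
Qed.

Definition state_t : state :=
  State (fun _ => 1) (fun _ => 0) (fun _ => 0) (fun _ => 0) (fun _ => 0) (fun _ => 0).
Definition state_h : state :=
  State (fun _ => 0) (fun _ => 0) (fun _ => 0) (fun _ => 0) (fun _ => 0) (fun _ => 1).

Definition state_combination (s1 s2 s3 s4 : state) (k0 k1 k2 k3 k4 h : R) : state :=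
  state_plus (state_plus (state_plus (state_plus (state_plus (state_scal k0 state_t)
    (state_scal k1 s1)) (state_scal k2 s2)) (state_scal k3 s3)) (state_scal k4 s4))
    (state_scal h state_h).

Ltac prove_flow :=
  intros t; cbn [tau tau1 tau2 alpha alpha1 delta];
  refine (conj _ (conj _ (conj _ (conj _ (conj _ _)))));
  auto_derive; trivial; try (field; auto).

Lemma flow_t (m c : R) : flow m c state_t.
Proof. unfold state_t; prove_flow. Qed.

Lemma flow_h (m c : R) : flow m c state_h.
Proof. unfold state_h; prove_flow. Qed.

Lemma field_of_h (sigma y : R -> R) (m c : R) : homogeneous = field_of sigma y m c state_h.
Proof. apply vfield_ext; intros; cbn; field. Qed.

Lemma field_of_t (sigma y : R -> R) (m c : R) : partial_t = field_of sigma y m c state_t.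
Proof. apply vfield_ext; intros; cbn; field. Qed.

Lemma combination_field_of (sigma y : R -> R) (m c : R) (s1 s2 s3 s4 : state)
    (k0 k1 k2 k3 k4 h : R) (b : R -> R -> R) :
  combination partial_t (field_of sigma y m c s1) (field_of sigma y m c s2)
    (field_of sigma y m c s3) (field_of sigma y m c s4) k0 k1 k2 k3 k4 h b =
  (field_of sigma y m c (state_combination s1 s2 s3 s4 k0 k1 k2 k3 k4 h)
   + infinity_field b)%VF.
Proof. apply vfield_ext; intros; cbn; field. Qed.

Lemma flow_combination (m c : R) (s1 s2 s3 s4 : state) (k0 k1 k2 k3 k4 h : R) :
  flow m c s1 -> flow m c s2 -> flow m c s3 -> flow m c s4 ->
  flow m c (state_combination s1 s2 s3 s4 k0 k1 k2 k3 k4 h).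
Proof.
  intros; repeat first [apply flow_plus | apply flow_scal | apply flow_t | apply flow_h]; trivial.
Qed.

Lemma field_of_veq (I : R -> Prop) (sigma Cx y : R -> R) (m c : R) (s : state) (b : R -> R -> R) :
  linear_drift I sigma Cx y m c -> (exists x, I x) -> flow m c s ->
  veq_on I (field_of sigma y m c s + infinity_field b)%VF vzero -> null_at s 0.
Proof.
  intros (HI & Hs & H0 & HC & Hy & _) [x Hx] Hf Hz.
  assert (D0 : forall f g : R -> R, (forall t, f t = 0) -> (forall t, is_derive f t (g t)) ->
     forall t, g t = 0).
  { intros f g Hf0 Hg t. rewrite <- (is_derive_unique _ _ _ (Hg t)).
    rewrite (Derive_ext _ (fun _ => 0)) by auto. apply Derive_const. }
  assert (E : forall t, tau s t = 0).
  { intros t; destruct (Hz t x 0 Hx) as (Z & _); cbn in Z; lra. }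
  assert (E1 : forall t, tau1 s t = 0) by (apply (D0 (tau s)); trivial; intros; apply Hf).
  assert (E2 : forall t, tau2 s t = 0) by (apply (D0 (tau1 s)); trivial; intros; apply Hf).
  assert (Ea : forall t, alpha s t = 0).
  { intros t; destruct (Hz t x 0 Hx) as (_ & Z & _); cbn in Z. rewrite E1 in Z.
    apply (Rmult_eq_reg_l (sigma x)); auto. lra. }
  assert (Ea1 : forall t, alpha1 s t = 0) by (apply (D0 (alpha s)); trivial; intros; apply Hf).
  (* The value at F = 0 is b itself; comparison with F = 1 removes it and leaves [delta]. *)
  destruct (Hz 0 x 0 Hx) as (_ & _ & Z0). destruct (Hz 0 x 1 Hx) as (_ & _ & Z1).
  cbn in Z0, Z1. rewrite E1, E2, Ea, Ea1 in Z0, Z1.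
  repeat split; trivial. lra.
Qed.

(** By uniqueness two flows agreeing at t = 0 define the same field, so the last two hypotheses,
    pure linear algebra on six initial values, yield generation and independence modulo the infinity
    fields. *)
Lemma generated_by_states (lo hi : Rbar) (sigma Cx y : R -> R) (m c : R)
    (s1 s2 s3 s4 : state) (Z1 Z2 Z3 Z4 : vfield) :
  let I := open_itv lo hi in
  Rbar_lt lo hi -> linear_drift I sigma Cx y m c ->
  flow m c s1 -> flow m c s2 -> flow m c s3 -> flow m c s4 ->
  Z1 = field_of sigma y m c s1 -> Z2 = field_of sigma y m c s2 ->
  Z3 = field_of sigma y m c s3 -> Z4 = field_of sigma y m c s4 ->
  (forall s, exists k0 k1 k2 k3 k4 h, null_at (state_plus s (state_scal (-1)
     (state_combination s1 s2 s3 s4 k0 k1 k2 k3 k4 h))) 0) ->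
  (forall k0 k1 k2 k3 k4 h, null_at (state_combination s1 s2 s3 s4 k0 k1 k2 k3 k4 h) 0 ->
     k0 = 0 /\ k1 = 0 /\ k2 = 0 /\ k3 = 0 /\ k4 = 0 /\ h = 0) ->
  symmetries_generated I (equation sigma Cx) partial_t Z1 Z2 Z3 Z4.
Proof.
  intros I Hne Hou F1 F2 F3 F4 -> -> -> -> Hspan Hfree.
  assert (HS := field_of_symmetry I sigma Cx y m c).
  refine (conj _ (conj (HS s1 Hou F1) (conj (HS s2 Hou F2) (conj (HS s3 Hou F3)
    (conj (HS s4 Hou F4) (conj _ (conj _ (conj _ _)))))))).
  - rewrite (field_of_t sigma y m c). apply HS; trivial. apply flow_t.
  - rewrite (field_of_h sigma y m c). apply HS; trivial. apply flow_h.
  - destruct Hou as (HI & Hs & _ & HC & _). intros b. apply infinity_field_symmetry; trivial.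
  - intros V HV. destruct (symmetry_form _ _ _ _ _ _ _ _ Hne Hou HV) as (s & b & Fs & Sb & E).
    destruct (Hspan s) as (k0 & k1 & k2 & k3 & k4 & h & Z).
    exists k0, k1, k2, k3, k4, h, b. split; trivial. rewrite combination_field_of.
    set (r := state_combination s1 s2 s3 s4 k0 k1 k2 k3 k4 h) in *.
    assert (Fr : flow m c r) by (apply flow_combination; trivial). clearbody r.
    assert (N := flow_unique m c _ (flow_plus m c _ _ Fs (flow_scal m c (-1) _ Fr)) Z).
    replace (field_of sigma y m c r) with (field_of sigma y m c s); trivial.
    apply vfield_ext; intros t x u; destruct (N t) as (N0 & N1 & N2 & N3 & N4 & N5); cbn in *.
    + lra.
    + replace (tau1 r t) with (tau1 s t) by lra. replace (alpha r t) with (alpha s t) by lra. trivial.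
    + replace (tau1 r t) with (tau1 s t) by lra. replace (alpha r t) with (alpha s t) by lra.
      replace (tau2 r t) with (tau2 s t) by lra. replace (alpha1 r t) with (alpha1 s t) by lra.
      replace (delta r t) with (delta s t) by lra. trivial.
  - intros k0 k1 k2 k3 k4 h b Sb Hz. apply Hfree.
    rewrite combination_field_of in Hz. eapply field_of_veq; [exact Hou | | | exact Hz].
    + apply open_itv_nonempty, Hne.
    + apply flow_combination; trivial.
Qed.

(** * Explicit bases of the linear system *)

(** For m nonzero the system has the exponents m, -m, 2m, -2m and twice 0. The four states that
    follow are eigenvectors for the nonzero exponents, and [state_t] and [state_h] span the
    constants. Their form is uniform in c. *)
Definition growing (m : R) : state :=
  State (fun _ => 0) (fun _ => 0) (fun _ => 0)
    (fun t => exp (m * t)) (fun t => m * exp (m * t)) (fun _ => 0).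
Definition decaying (m c : R) : state :=
  State (fun _ => 0) (fun _ => 0) (fun _ => 0)
    (fun t => exp (- (m * t))) (fun t => - m * exp (- (m * t)))
    (fun t => 2 * c * exp (- (m * t))).
Definition growing2 (m c : R) : state :=
  State (fun t => exp (2 * m * t)) (fun t => 2 * m * exp (2 * m * t))
    (fun t => 4 * m ^ 2 * exp (2 * m * t)) (fun t => c * exp (2 * m * t))
    (fun t => 2 * m * c * exp (2 * m * t)) (fun _ => 0).
Definition decaying2 (m c : R) : state :=
  State (fun t => exp (- (2 * m * t))) (fun t => - 2 * m * exp (- (2 * m * t)))
    (fun t => 4 * m ^ 2 * exp (- (2 * m * t))) (fun t => - c * exp (- (2 * m * t)))
    (fun t => 2 * m * c * exp (- (2 * m * t)))
    (fun t => (m - 2 * c ^ 2) * exp (- (2 * m * t))).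

Lemma generated_exponential (lo hi : Rbar) (sigma Cx y : R -> R) (m c : R)
    (Z1 Z2 Z3 Z4 : vfield) :
  let I := open_itv lo hi in
  Rbar_lt lo hi -> linear_drift I sigma Cx y m c -> m <> 0 ->
  Z1 = field_of sigma y m c (growing m) -> Z2 = field_of sigma y m c (decaying m c) ->
  Z3 = field_of sigma y m c (growing2 m c) -> Z4 = field_of sigma y m c (decaying2 m c) ->
  symmetries_generated I (equation sigma Cx) partial_t Z1 Z2 Z3 Z4.
Proof.
  intros I Hne Hou Hm E1 E2 E3 E4.
  apply (generated_by_states lo hi sigma Cx y m c (growing m) (decaying m c)
    (growing2 m c) (decaying2 m c)); trivial.
  - unfold growing; prove_flow.
  - unfold decaying; prove_flow.
  - unfold growing2; prove_flow.
  - unfold decaying2; prove_flow.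
  (* Matching values at t = 0, the numbers [v1], [v2], [v3], [v4] are k3 - k4, k3 + k4, k1 + k2 and
     k1 - k2; [tau] and [delta] then fix k0 and h. *)
  - intros s. set (v1 := tau1 s 0 / (2 * m)). set (v2 := tau2 s 0 / (4 * m ^ 2)).
    set (v3 := alpha s 0 - c * v1). set (v4 := alpha1 s 0 / m - 2 * c * v2).
    exists (tau s 0 - v2), ((v3 + v4) / 2), ((v3 - v4) / 2), ((v2 + v1) / 2), ((v2 - v1) / 2),
      (delta s 0 - c * (v3 - v4) - (m - 2 * c ^ 2) * (v2 - v1) / 2).
    unfold null_at; cbn. rewrite !Rmult_0_r, Ropp_0, exp_0.
    unfold v4, v3, v2, v1; repeat split; field; auto.
  - intros k0 k1 k2 k3 k4 h (N0 & N1 & N2 & N3 & N4 & N5). cbn in *.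
    rewrite !Rmult_0_r, ?Ropp_0, exp_0 in *.
    assert (A1 : k3 - k4 = 0) by (apply (Rmult_eq_reg_l (2 * m)); lra).
    assert (A2 : k3 + k4 = 0).
    { apply (Rmult_eq_reg_l (4 * m ^ 2)); [lra|].
      apply Rmult_integral_contrapositive; split; [lra | apply pow_nonzero; trivial]. }
    assert (k3 = 0) by lra; assert (k4 = 0) by lra; subst k3 k4.
    assert (A3 : k1 - k2 = 0) by (apply (Rmult_eq_reg_l m); lra).
    assert (k1 = 0) by lra; assert (k2 = 0) by lra; subst k1 k2.
    repeat split; lra.
Qed.

Definition translation : state :=
  State (fun _ => 0) (fun _ => 0) (fun _ => 0) (fun _ => 1) (fun _ => 0) (fun _ => 0).
Definition galilean (c : R) : state :=
  State (fun _ => 0) (fun _ => 0) (fun _ => 0) (fun t => t) (fun _ => 1) (fun t => c * t).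
Definition scaling (c : R) : state :=
  State (fun t => 2 * t) (fun _ => 2) (fun _ => 0) (fun t => c * t) (fun _ => c) (fun _ => 0).
(** Changing [e] adds a multiple of [galilean c]. The value e = 1/(2c) cancels the linear term of
    [delta], whence the coefficient in the listed fourth vector. *)
Definition projective (c e : R) : state :=
  State (fun t => t ^ 2) (fun t => 2 * t) (fun _ => 2) (fun t => e * t) (fun _ => e)
    (fun t => (c * e - / 2) * t - c ^ 2 / 2 * t ^ 2).

Lemma generated_polynomial (lo hi : Rbar) (sigma Cx y : R -> R) (c e : R)
    (Z1 Z2 Z3 Z4 : vfield) :
  let I := open_itv lo hi in
  Rbar_lt lo hi -> linear_drift I sigma Cx y 0 c ->
  Z1 = field_of sigma y 0 c translation -> Z2 = field_of sigma y 0 c (galilean c) ->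
  Z3 = field_of sigma y 0 c (scaling c) -> Z4 = field_of sigma y 0 c (projective c e) ->
  symmetries_generated I (equation sigma Cx) partial_t Z1 Z2 Z3 Z4.
Proof.
  intros I Hne Hou E1 E2 E3 E4.
  apply (generated_by_states lo hi sigma Cx y 0 c translation (galilean c)
    (scaling c) (projective c e)); trivial.
  - unfold translation; prove_flow.
  - unfold galilean; prove_flow.
  - unfold scaling; prove_flow.
  - unfold projective; prove_flow.
  - intros s.
    (* At t = 0 the combination has [tau1] = 2 k3, [tau2] = 2 k4 and [alpha1] = k2 + c k3 + e k4. *)
    exists (tau s 0), (alpha s 0), (alpha1 s 0 - c * tau1 s 0 / 2 - e * tau2 s 0 / 2),
      (tau1 s 0 / 2), (tau2 s 0 / 2), (delta s 0).
    unfold null_at; cbn. repeat split; field.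
  - intros k0 k1 k2 k3 k4 h (N0 & N1 & N2 & N3 & N4 & N5). cbn in *.
    assert (k3 = 0) by lra; assert (k4 = 0) by lra; subst k3 k4.
    repeat split; lra.
Qed.

Theorem corollary4 (lo hi : Rbar) (sigma Cx y : R -> R)
  (Hne : Rbar_lt lo hi)
  (Hsigma : smooth_on (open_itv lo hi) sigma)
  (Hsigma0 : forall x, open_itv lo hi x -> sigma x <> 0)
  (HCx : smooth_on (open_itv lo hi) Cx)
  (Hy : forall x, open_itv lo hi x -> is_derive y x (/ sigma x))
  (HK : exists T : R -> R, (exists t, T t <> 0) /\
     lie_symmetry (open_itv lo hi) (equation sigma Cx)
       ((fun t _ _ => T t) ** killing sigma)%VF) :
  let I := open_itv lo hi in
  let E := equation sigma Cx in
  let K1 := killing sigma in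
  let H := homothetic sigma y in
  exists m c : R,
    (forall x, I x -> Cx x = m * sigma x * y x + c * sigma x) /\
    maximally_symmetric I E /\
    (m <> 0 -> c = 0 ->
     symmetries_generated I E partial_t
       ((fun t _ _ => exp (m * t)) ** K1)%VF
       ((fun t _ _ => exp (- (m * t)))
          ** (K1 + (fun _ x _ => 2 * m * y x) ** homogeneous))%VF
       ((fun t _ _ => exp (2 * m * t)) ** (partial_t + m *: H))%VF
       ((fun t _ _ => exp (- (2 * m * t)))
          ** (partial_t - m *: H
              - (fun _ x _ => m * (2 * m * y x ^ 2 - 1)) ** homogeneous))%VF) /\
    (m <> 0 -> c <> 0 ->
     symmetries_generated I E partial_t
       ((fun t _ _ => exp (m * t)) ** K1)%VF
       ((fun t _ _ => exp (- (m * t)))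
          ** (K1 + (fun _ x _ => 2 * (m * y x + c)) ** homogeneous))%VF
       ((fun t _ _ => exp (2 * m * t)) ** (partial_t + m *: H + c *: K1))%VF
       ((fun t _ _ => exp (- (2 * m * t)))
          ** (partial_t - m *: H - c *: K1
              - (fun _ x _ => 2 * m ^ 2 * y x ^ 2 + 4 * m * c * y x
                              + 2 * c ^ 2 - m) ** homogeneous))%VF) /\
    (m = 0 -> c <> 0 ->
     symmetries_generated I E partial_t
       K1
       ((fun t _ _ => t) ** K1
          - (fun t x _ => y x - c * t) ** homogeneous)%VF
       ((fun t _ _ => 2 * t) ** partial_t + H + (fun t _ _ => c * t) ** K1)%VF
       ((fun t _ _ => t ^ 2) ** partial_t + (fun t _ _ => t) ** H
          + (fun t _ _ => t / (2 * c)) ** K1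
          - (fun t x _ => / 2 * y x ^ 2 + / (2 * c) * y x - c * t * y x
                          + c ^ 2 / 2 * t ^ 2) ** homogeneous)%VF).
Proof.
  intros I E K1 H. destruct HK as (T & [t0 Ht0] & HT).
  destruct (drift_of_killing lo hi sigma Cx y T t0) as (m & c & HCy); trivial.
  exists m, c. split; [exact HCy|].
  assert (Hou : linear_drift I sigma Cx y m c) by
    exact (conj (open_itv_open lo hi) (conj Hsigma (conj Hsigma0 (conj HCx (conj Hy HCy))))).
  split; [|split; [|split]].
  - destruct (Req_dec m 0) as [->|Hm]; do 4 eexists.
    (* The choice e = 0 is independent of c and so includes m = c = 0, where 1/(2c) would be
       meaningless. *)
    + eexists; apply (generated_polynomial lo hi sigma Cx y c 0); trivial; reflexivity.
    + eexists; apply (generated_exponential lo hi sigma Cx y m c); trivial; reflexivity.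
  (* The vectors of case (i) are those of case (ii) at c = 0, so one basis serves both. *)
  - intros Hm ->. apply (generated_exponential lo hi sigma Cx y m 0); trivial;
      apply vfield_ext; intros; cbn; field.
  - intros Hm _. apply (generated_exponential lo hi sigma Cx y m c); trivial;
      apply vfield_ext; intros; cbn; field.
  - intros -> Hc. apply (generated_polynomial lo hi sigma Cx y c (/ (2 * c))); trivial;
      apply vfield_ext; intros; cbn; field; trivial.
Qed.
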